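(* Let $p>1$, let $\Omega\subset\mathbb{R}^N$ ($N\ge 1$) be a bounded domain of class $C^{1,1}$, fix $\gamma>N$, and let $f\in L^\gamma(\Omega)$ satisfy $f\ge0$, $f\not\equiv0$ in $\Omega$. Let $$\Omega_f^0=\bigcup\{U\subset\Omega:\ U\text{ is open and } f=0\text{ a.e. in }U\}.$$ If $\Omega_f^0\ne\emptyset$, then $\widetilde\lambda_f\le\lambda_1(\Omega_f^0)<+\infty$.
   Context: For $\lambda\in\mathbb{R}$ consider problem $(\mathcal{D}_\lambda)$: $-\Delta_p u=\lambda|u|^{p-2}u+f$ in $\Omega$, $u=0$ on $\partial\Omega$, where $\Delta_p u=\operatorname{div}(|\nabla u|^{p-2}\nabla u)$. A solution is a weak solution: $u\in W_0^{1,p}(\Omega)$ with $\int_\Omega|\nabla u|^{p-2}\nabla u\cdot\nabla\xi\,dx=\lambda\int_\Omega|u|^{p-2}u\,\xi\,dx+\int_\Omega f\xi\,dx$ for all $\xi\in W_0^{1,p}(\Omega)$. Weak solutions belong to $C^{1,\beta}(\overline\Omega)$ for some $\beta\in(0,1)$; a solution is negative if $u<0$ everywhere in $\Omega$. For a nonempty bounded open set $U$, $\lambda_1(U)=\inf\{\int_U|\nabla u|^p\,dx/\int_U|u|^p\,dx:\ u\in W_0^{1,p}(U)\setminus\{0\}\}$, and $\lambda_1=\lambda_1(\Omega)$. Define $\widetilde\lambda_f=\sup\{\lambda>\lambda_1:\ (\mathcal{D}_\lambda)\text{ has a negative solution}\}\in(\lambda_1,+\infty]$. *)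

(* Defs.v *)
From HB Require Import structures.
From mathcomp Require Import all_boot all_order all_algebra.
From mathcomp Require Import all_classical all_reals all_analysis.

Set Implicit Arguments.
Unset Strict Implicit.
Unset Printing Implicit Defensive.

Import Order.TTheory GRing.Theory Num.Theory.
Import numFieldNormedType.Exports.

Local Open Scope classical_set_scope.
Local Open Scope ring_scope.

(* Points of R^n are row vectors.  As for n.-tuple in the library, the
   sigma-algebra is the one generated by the coordinates; it consists of the
   Borel sets of R^n. *)
Definition measure_rV_display : measure_display.
Proof. exact: default_measure_display. Qed.

Section measurable_rV.
Context (R : realType) (n : nat).

Let coords : 'I_n -> 'rV[R]_n -> measurableTypeR R := fun i x => x ord0 i.

Let rV_set0 : g_sigma_preimage coords set0.
Proof. exact: sigma_algebra0. Qed.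

Let rV_setC A : g_sigma_preimage coords A -> g_sigma_preimage coords (~` A).
Proof. exact: sigma_algebraC. Qed.

Let rV_bigcup (F : (set 'rV[R]_n)^nat) :
  (forall i, g_sigma_preimage coords (F i)) ->
  g_sigma_preimage coords (\bigcup_i (F i)).
Proof. exact: sigma_algebra_bigcup. Qed.

HB.instance Definition _ :=
  @isMeasurable.Build measure_rV_display 'rV[R]_n
    (g_sigma_preimage coords) rV_set0 rV_setC rV_bigcup.

Lemma measurable_rV_coord (i : 'I_n) :
  measurable_fun [set: 'rV[R]_n]
    (fun x => x ord0 i : measurableTypeR R).
Proof.
move=> _ Y mY; rewrite setTI; apply: sub_sigma_algebra => /=.
rewrite -bigcup_seq/=; exists i => /=; first by rewrite mem_index_enum.
by exists Y => //; rewrite setTI.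
Qed.

Lemma measurable_fun_rV d (T : measurableType d) (f : T -> 'rV[R]_n) :
  (forall i, measurable_fun [set: T]
     (fun t => f t ord0 i : measurableTypeR R)) ->
  measurable_fun [set: T] f.
Proof.
move=> mf; suff : g_sigma_preimage (fun i t => coords i (f t)) `<=` measurable.
  have -> : g_sigma_preimage (fun i t => coords i (f t)) =
            preimage_set_system [set: T] f (g_sigma_preimage coords).
    exact: (g_sigma_preimage_comp coords f).
  by move=> fsub _ A mA; apply: fsub; exists A.
apply: smallest_sub; first exact: sigma_algebra_measurable.
rewrite -bigcup_seq; apply: bigcup_sub => i _ A [B mB <-].
exact: mf.
Qed.

End measurable_rV.

Section rV_cons.
Context (R : realType) (n : nat).

Definition rV_cons (z : measurableTypeR R * 'rV[R]_n) : 'rV[R]_n.+1 :=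
  \row_i oapp (fun j => z.2 ord0 j) z.1 (unlift ord0 i).

Definition rV_uncons (x : 'rV[R]_n.+1) : measurableTypeR R * 'rV[R]_n :=
  (x ord0 ord0, \row_j x ord0 (lift ord0 j)).

Lemma rV_consK : cancel rV_cons rV_uncons.
Proof.
case=> a v; rewrite /rV_uncons /rV_cons; congr pair.
  by rewrite mxE unlift_none.
by apply/rowP => j; rewrite !mxE liftK.
Qed.

Lemma measurable_rV_cons : measurable_fun setT rV_cons.
Proof.
apply: measurable_fun_rV => i; rewrite /rV_cons.
case: (unliftP ord0 i) => [j ->|->].
- rewrite [X in measurable_fun _ X](_ : _ =
    (fun x : 'rV[R]_n => x ord0 j : measurableTypeR R) \o snd); last first.
    by apply/funext => z /=; rewrite mxE liftK.
  exact: measurableT_comp (measurable_rV_coord j) measurable_snd.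
- rewrite [X in measurable_fun _ X](_ : _ = fst).
    exact: measurable_fst.
  by apply/funext => z /=; rewrite mxE unlift_none.
Qed.

Lemma measurable_rV_uncons : measurable_fun setT rV_uncons.
Proof.
apply: measurable_fun_pair => /=.
  exact: measurable_rV_coord.
apply: measurable_fun_rV => i.
rewrite [X in measurable_fun _ X](_ : _ =
    (fun x : 'rV[R]_n.+1 => x ord0 (lift ord0 i) : measurableTypeR R)).
  exact: measurable_rV_coord.
by apply/funext => x; rewrite mxE.
Qed.

HB.instance Definition _ :=
  isMeasurableFun.Build _ _ _ _ rV_cons measurable_rV_cons.

End rV_cons.

Section lebesgue_rV_succ.
Context (R : realType) (n : nat).
Variable m : {sigma_finite_measure set 'rV[R]_n -> \bar R}.

Definition lebesgue_rV_succ : set 'rV[R]_n.+1 -> \bar R :=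
  pushforward (lebesgue_measure \x m)%E (@rV_cons R n).

Let lebesgue_rV_succ0 : lebesgue_rV_succ set0 = 0%E.
Proof. exact: measure0. Qed.

Let lebesgue_rV_succ_ge0 A : (0 <= lebesgue_rV_succ A)%E.
Proof. exact: measure_ge0. Qed.

Let lebesgue_rV_succ_sigma_additive : semi_sigma_additive lebesgue_rV_succ.
Proof. exact: measure_semi_sigma_additive. Qed.

HB.instance Definition _ := isMeasure.Build _ _ _ lebesgue_rV_succ
  lebesgue_rV_succ0 lebesgue_rV_succ_ge0 lebesgue_rV_succ_sigma_additive.

Let lebesgue_rV_succ_sigma_finite : sigma_finite setT lebesgue_rV_succ.
Proof.
have /sigma_finiteP[F [TF ndF Foo]] := sigma_finiteT (@lebesgue_measure R).
have /sigma_finiteP[G [TG ndG Goo]] := sigma_finiteT m.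
exists (fun k => @rV_uncons R n @^-1` (F k `*` G k)).
  rewrite -preimage_bigcup -[LHS](preimage_setT (@rV_uncons R n)); congr preimage.
  rewrite -setXTT TF TG predeqE => -[x y]; split.
    move=> [/= [i _ Fix] [j _ Gjy]]; exists (maxn i j) => //; split.
    - by move: x Fix; exact/subsetPset/ndF/leq_maxl.
    - by move: y Gjy; exact/subsetPset/ndG/leq_maxr.
  by move=> [i _ []/= ? ?]; split; exists i.
move=> k; have [mF Fk] := Foo k; have [mG Gk] := Goo k; split.
  rewrite -[X in measurable X]setTI.
  by apply: measurable_rV_uncons => //; exact: measurableX.
rewrite /lebesgue_rV_succ /pushforward -comp_preimage.
rewrite [X in X @^-1` _](_ : _ = id); last first.
  by apply/funext => z /=; exact: rV_consK.
by rewrite preimage_id product_measure1E// lte_mul_pinfty// ge0_fin_numE.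
Qed.

HB.instance Definition _ := @Measure_isSigmaFinite.Build _ _ _
  lebesgue_rV_succ lebesgue_rV_succ_sigma_finite.

End lebesgue_rV_succ.

(* Lebesgue measure on R^n, as the n-fold product of the one on R. *)
Fixpoint lebesgue_rV (R : realType) (n : nat) :
    {sigma_finite_measure set 'rV[R]_n -> \bar R} :=
  match n with
  | 0 => dirac (0 : 'rV[R]_0)
  | n.+1 => lebesgue_rV_succ (lebesgue_rV R n)
  end.

Section euclidean.
Context (R : realType) (n : nat).
Implicit Types x y : 'rV[R]_n.

Definition dotp x y : R := \sum_i x ord0 i * y ord0 i.

(* The library norm on row vectors is the sup norm. *)
Definition enorm x : R := Num.sqrt (dotp x x).

End euclidean.

Section smooth_functions.
Context (R : realType) (n : nat).
Implicit Types (phi : 'rV[R]_n -> R) (U : set 'rV[R]_n).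

Definition partial (i : 'I_n) phi : 'rV[R]_n -> R :=
  'D_(delta_mx ord0 i) phi.

Fixpoint Cn (k : nat) phi : Prop :=
  continuous phi /\
  match k with
  | 0 => True
  | k.+1 => forall i, (forall x, derivable phi x (delta_mx ord0 i)) /\
                      Cn k (partial i phi)
  end.

Definition Cc_infty U phi : Prop :=
  [/\ forall k, Cn k phi,
      compact (closure [set x | phi x != 0]) &
      closure [set x | phi x != 0] `<=` U].

(* C^{1,1}: all the first partial derivatives exist and are Lipschitz. *)
Definition C11 phi : Prop :=
  (forall x i, derivable phi x (delta_mx ord0 i)) /\
  exists L : R, forall x y i,
    `|partial i phi x - partial i phi y| <= L * enorm (x - y).

End smooth_functions.

(* Near each boundary point, after a rigid change of coordinates
   y = (x - x0) Q, the set is the part of a ball lying above the graph of a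
   C^{1,1} function of all the coordinates of y but the last one. *)
Definition C11_boundary (R : realType) (n : nat)
    (Omega : set 'rV[R]_n.+1) : Prop :=
  forall x0, (closure Omega `\` interior Omega) x0 ->
  exists (r : R) (Q : 'M[R]_n.+1) (h : 'rV[R]_n -> R),
    [/\ 0 < r, Q *m Q^T = 1%:M, C11 h &
        forall x, enorm (x - x0) < r ->
          let y := (x - x0) *m Q in
          Omega x <-> h (col' ord_max y) < y ord0 ord_max].

Definition C11_domain (R : realType) (n : nat)
    (Omega : set 'rV[R]_n.+1) : Prop :=
  [/\ Omega !=set0, open Omega, connected Omega, bounded_set Omega &
      C11_boundary Omega].

Section sobolev.
Context (R : realType) (n : nat).
Implicit Types (U : set 'rV[R]_n) (p : R) (u f : 'rV[R]_n -> R)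
  (g : 'rV[R]_n -> 'rV[R]_n).
Local Notation mu := (lebesgue_rV R n).

Definition ae_in U (P : 'rV[R]_n -> Prop) : Prop :=
  {ae mu, forall x, U x -> P x}.

Definition Lp p U : set ('rV[R]_n -> R) :=
  [set u | u \_ U \in Lfun mu p%:E].

Definition Lp_cvg p U (u_ : nat -> 'rV[R]_n -> R) u : Prop :=
  'N[mu]_p%:E[EFin \o ((u_ k \- u)%R \_ U)]%E @[k --> \oo] --> 0%E.

Definition weak_gradient U u g : Prop :=
  forall phi, Cc_infty U phi -> forall i,
    \int[mu]_(x in U) (u x * partial i phi x) =
    - \int[mu]_(x in U) (g x ord0 i * phi x).

(* The pair (u, g) stands for the Sobolev function u together with (a
   representative of) its gradient g. *)
Definition W1p p U u g : Prop :=
  [/\ Lp p U u, forall i, Lp p U (fun x => g x ord0 i) & weak_gradient U u g].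

Definition W01p p U u g : Prop :=
  W1p p U u g /\
  exists phi_ : nat -> 'rV[R]_n -> R,
    [/\ forall k, Cc_infty U (phi_ k),
        Lp_cvg p U phi_ u &
        forall i,
          Lp_cvg p U (fun k => partial i (phi_ k)) (fun x => g x ord0 i)].

Definition rayleigh p U u g : R :=
  (\int[mu]_(x in U) (enorm (g x) `^ p)) / (\int[mu]_(x in U) (`|u x| `^ p)).

Definition lambda1 p U : \bar R :=
  ereal_inf [set l | exists u g,
    [/\ W01p p U u g, ~ ae_in U (fun x => u x = 0) &
        l = (rayleigh p U u g)%:E]].

(* For 1 < p < 2 the powers `^ (p - 2) are multiplied by 0 where their base
   vanishes. *)
Definition weak_solution p Omega f (lambda : R) u : Prop :=
  exists2 g, W01p p Omega u g & forall xi dxi, W01p p Omega xi dxi ->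
    \int[mu]_(x in Omega) (enorm (g x) `^ (p - 2) * dotp (g x) (dxi x)) =
    lambda * \int[mu]_(x in Omega) (`|u x| `^ (p - 2) * u x * xi x) +
    \int[mu]_(x in Omega) (f x * xi x).

(* Weak solutions are defined up to null sets; the pointwise sign is that of
   the continuous representative. *)
Definition negative_solution p Omega f lambda u : Prop :=
  [/\ weak_solution p Omega f lambda u, {in Omega, continuous u} &
      forall x, Omega x -> u x < 0].

Definition lambda_tilde p Omega f : \bar R :=
  ereal_sup [set lambda%:E | lambda in [set lambda : R |
    (lambda1 p Omega < lambda%:E)%E /\
    exists u, negative_solution p Omega f lambda u]].

Definition Omega_f0 Omega f : set 'rV[R]_n :=
  \bigcup_(U in [set U | [/\ U `<=` Omega, open U &
                             ae_in U (fun x => f x = 0)]]) U.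

End sobolev.

(* Main.v *)
(** Let [u] be a negative solution for the parameter [lambda] and let [phi] be
    a test function supported in [Omega_f0], where [f] vanishes.  Testing the
    equation with [|phi|^p / |u|^(p-1)] and applying Picone's inequality gives
    [lambda * int |phi|^p <= int |grad phi|^p], because the source term drops
    out.  Density of test functions in W_0^{1,p} then bounds [lambda] by every
    Rayleigh quotient on [Omega_f0].  To stay within C_c^infty approximations,
    the test function is replaced by
    [((phi^2 + e)^(p/2) - e^(p/2)) * (u^2 + s)^((1-p)/2)],
    which is a smooth compactly supported factor times a smooth function of
    [u]; the errors disappear when first [e] and then [s] tend to 0.
    Finiteness only needs one nonzero test function, built from [exp (-1/x)]. *)

Require Import Defs.
From HB Require Import structures.
From mathcomp Require Import all_boot all_order all_algebra.
From mathcomp Require Import all_classical all_reals all_analysis.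
From mathcomp Require Import measurable_realfun ring lra.

Set Implicit Arguments.
Unset Strict Implicit.
Unset Printing Implicit Defensive.

Import Order.TTheory GRing.Theory Num.Theory.
Import numFieldNormedType.Exports.

Local Open Scope classical_set_scope.
Local Open Scope ring_scope.

(** * The classes C^k *)

(** The weak equation may only be tested with members of W_0^{1,p}, and those are given as limits of
    test functions. The approximations of [u] carry no sign, so the singular power [|t|^(1-p)]
    cannot be composed with them: the function of [u] must be smooth and bounded on all of R, with a
    bounded Lipschitz derivative. This is why [s > 0] appears. It costs little because [u] is
    continuous and negative, so [-u >= c > 0] on the compact support [K] of [phi]; there [|u|] and
    [sqrt (u^2 + s)] agree up to a factor [th < 1], and [s] is taken as a function of [th].
    Subtracting [e^(p/2)] restores the compact support that adding [e] destroys. In Picone's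
    inequality, Young's inequality with weight [th] then cancels every term in [|grad u|^p] except
    one of size [e^(p/2) * s^(-p/2)]. It is integrable but explodes as [s] tends to 0, which
    dictates the order of the limits. *)

Section smooth.
Context (R : realType) (n : nat).
Implicit Types (phi psi : 'rV[R]_n -> R).

(** Only one directional derivative of [f] is available, not its differential, so the rule is
    reduced to the one-variable chain rule along the line [h |-> h *: v + x]. *)
Lemma is_derive_comp_line (V : normedModType R) (f : V -> R) (g : R -> R)
    (x v : V) (df dg : R) :
  is_derive x v f df -> is_derive (f x) 1 g dg ->
  is_derive x v (g \o f) (dg * df).
Proof.
move=> [fx <-] gfx.
pose l := fun h : R => f (h *: v + x).
have l0 : l 0 = f x by rewrite /l scale0r add0r.
have dl : is_derive (0 : R) (1 : R) l ('D_v f x).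
  apply: DeriveDef; first exact: (derivable1P f x v).1.
  rewrite /derive; set g1 := fun h => _; set g2 := fun h => _.
  suff -> : g1 = g2 by [].
  by apply/funext => h; rewrite /g1 /g2 /l /= addr0 scale0r add0r [_%:A]mulr1.
have gl0 : is_derive (l 0) 1 g dg by rewrite l0.
have [glx <-] := is_derive1_comp gl0 dl.
apply: DeriveDef; first exact: (derivable1P (g \o f) x v).2.
rewrite /derive; set g1 := fun h => _; set g2 := fun h => _.
suff -> : g1 = g2 by [].
by apply/funext => h; rewrite /g1 /g2 /l /= addr0 scale0r add0r [_%:A]mulr1.
Qed.

Definition has_partial i phi dphi :=
  forall x : 'rV[R]_n, is_derive x (delta_mx ord0 i) phi (dphi x).

Lemma has_partialP i phi : (forall x, derivable phi x (delta_mx ord0 i)) ->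
  has_partial i phi (partial i phi).
Proof. by move=> dphi x; exact: derivableP. Qed.

Lemma has_partial_eq i phi dphi : has_partial i phi dphi -> partial i phi = dphi.
Proof. by move=> h; apply/funext => x; have [_] := h x. Qed.

Lemma CnS k phi : Cn k.+1 phi -> Cn k phi.
Proof.
elim: k phi => [phi [] //|k IH phi [cphi h]]; split => // i.
by have [d c] := h i; split => //; exact: IH.
Qed.

Lemma Cn_continuous k phi : Cn k phi -> continuous phi.
Proof. by case: k => [|k] []. Qed.

Lemma CnS_intro k phi (dphi : 'I_n -> 'rV[R]_n -> R) : continuous phi ->
  (forall i, has_partial i phi (dphi i)) -> (forall i, Cn k (dphi i)) -> Cn k.+1 phi.
Proof.
move=> cphi d c; split => // i; split; first by move=> x; have [] := d i x.
by rewrite (has_partial_eq (d i)).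
Qed.

Lemma CnS_has_partial k phi i : Cn k.+1 phi -> has_partial i phi (partial i phi).
Proof. by move=> [_ h]; apply: has_partialP; have [] := h i. Qed.

Lemma Cn_cst k (c : R) : Cn k (fun _ : 'rV[R]_n => c).
Proof.
elim: k c => [c|k IH c]; first by split => // x; exact: cst_continuous.
apply: (@CnS_intro k (fun=> c) (fun _ _ => 0)) => [x|i x|i]; first exact: cst_continuous.
  exact: is_derive_cst.
exact: IH.
Qed.

Lemma has_partialD i phi psi dphi dpsi : has_partial i phi dphi -> has_partial i psi
    dpsi ->
  has_partial i (fun x => phi x + psi x) (fun x => dphi x + dpsi x).
Proof. by move=> h1 h2 x; exact: (is_deriveD (h1 x) (h2 x)). Qed.

Lemma has_partialM i phi psi dphi dpsi : has_partial i phi dphi -> has_partial i psi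
    dpsi ->
  has_partial i (fun x => phi x * psi x) (fun x => phi x * dpsi x + psi x * dphi x).
Proof. by move=> h1 h2 x; exact: (is_deriveM (h1 x) (h2 x)). Qed.

Lemma has_partial_comp i phi dphi (g dg : R -> R) : has_partial i phi dphi ->
  (forall x, is_derive (phi x) 1 g (dg (phi x))) ->
  has_partial i (fun x => g (phi x)) (fun x => dg (phi x) * dphi x).
Proof. by move=> h1 h2 x; exact: (is_derive_comp_line (h1 x) (h2 x)). Qed.

Lemma CnD k phi psi : Cn k phi -> Cn k psi -> Cn k (fun x => phi x + psi x).
Proof.
elim: k phi psi => [|k IH] phi psi h1 h2;
  have c1 := Cn_continuous h1; have c2 := Cn_continuous h2;
  (have c : continuous (fun x => phi x + psi x) by move=> x;
    exact: (continuousD (c1 x) (c2 x))).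
  by split.
apply: (CnS_intro c (fun i => has_partialD (CnS_has_partial i h1) (CnS_has_partial i
    h2))) => i.
by apply: IH; [case: h1 => _ /(_ i)[]|case: h2 => _ /(_ i)[]].
Qed.

Lemma CnM k phi psi : Cn k phi -> Cn k psi -> Cn k (fun x => phi x * psi x).
Proof.
elim: k phi psi => [|k IH] phi psi h1 h2;
  have c1 := Cn_continuous h1; have c2 := Cn_continuous h2;
  (have c : continuous (fun x => phi x * psi x) by move=> x;
    exact: (continuousM (c1 x) (c2 x))).
  by split.
apply: (CnS_intro c (fun i => has_partialM (CnS_has_partial i h1) (CnS_has_partial i
    h2))) => i.
by apply: CnD; apply: IH; try exact: CnS; [case: h2 => _ /(_ i)[]|case: h1 => _ /(_ i)[]].
Qed.

(* [step j] writes the derivative of [g j] as a linear combination of members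
   of the family, so that the induction on [k] can run on all of them. *)
Lemma Cn_comp (I : Type) (g : I -> R -> R) (D : set R)
   (step : I -> seq (R * I)) :
  (forall j x, D x -> is_derive x 1 (g j) (\sum_(s <- step j) s.1 * g s.2 x)) ->
  forall k j phi, (forall x, D (phi x)) -> Cn k phi -> Cn k (fun x => g j (phi x)).
Proof.
move=> gd; elim=> [|k IH] j phi Dphi h.
all: have c : continuous (fun x => g j (phi x)).
1,3: move=> x; apply: (@continuous_comp _ _ _ phi (g j)); first exact: (Cn_continuous h).
1,2: by apply/differentiable_continuous/derivable1_diffP; have [] := gd j _ (Dphi x).
  by split.
have dc i : has_partial i (fun x => g j (phi x)) (fun x => (\sum_(s <- step j) s.1 *
    g s.2 (phi x)) * partial i phi x).
  apply: (has_partial_comp (dg := fun y => \sum_(s <- step j) s.1 * g s.2 y))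
      (CnS_has_partial i h) _ => x.
  exact: gd.
apply: (CnS_intro c dc) => i.
apply: CnM; last by case: h => _ /(_ i)[].
elim: (step j) => [|s s' IHs].
  rewrite [X in Cn _ X](_ : _ = fun=> 0); first exact: Cn_cst.
  by apply/funext => x; rewrite big_nil.
rewrite [X in Cn _ X](_ : _ = fun x => s.1 * g s.2 (phi x) + \sum_(s <- s') s.1 * g
    s.2 (phi x)).
  apply: CnD => //; apply: CnM; first exact: Cn_cst.
  by apply: IH => //; exact: CnS.
by apply/funext => x; rewrite big_cons.
Qed.

(** The family is indexed by the exponent: on positive reals, differentiating leads from [q] to
    [q - 1] with coefficient [q]. *)
Lemma Cn_powR k phi (q : R) : (forall x, 0 < phi x) -> Cn k phi ->
  Cn k (fun x => phi x `^ q).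
Proof.
apply: (@Cn_comp R (fun q x => x `^ q) [set x | 0 < x] (fun q => [:: (q, q - 1)])).
move=> {}q x x0; rewrite big_seq1; exact: is_derive1_powR.
Qed.

Lemma Cn_coord k j : Cn k (fun x : 'rV[R]_n => x ord0 j).
Proof.
have d i : has_partial i (fun x : 'rV[R]_n => x ord0 j) (fun=> (j == i)%:R).
  move=> x; apply: DeriveDef.
    by apply: diff_derivable; exact: differentiable_coord.
  apply: lim_near_cst; first exact: Rhausdorff.
  near=> h.
  have h0 : h != 0 by near: h; exact: nbhs_dnbhs_neq.
  by rewrite /= !mxE eqxx/= addrK scalerA mulVf// scale1r.
case: k => [|k]; first by split => // x; exact: coord_continuous.
apply: (CnS_intro _ d); first by move=> x; exact: coord_continuous.
by move=> i; exact: Cn_cst.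
Unshelve. all: by end_near.
Qed.

Lemma Cn_sum (I : Type) (r : seq I) k (F : I -> 'rV[R]_n -> R) :
  (forall j, Cn k (F j)) -> Cn k (fun x => \sum_(j <- r) F j x).
Proof.
move=> h; elim: r => [|j r IH].
  rewrite [X in Cn _ X](_ : _ = fun=> 0); first exact: Cn_cst.
  by apply/funext => x; rewrite big_nil.
rewrite [X in Cn _ X](_ : _ = fun x => F j x + \sum_(j <- r) F j x).
  exact: CnD.
by apply/funext => x; rewrite big_cons.
Qed.

End smooth.

(** * Lebesgue measure and the Borel sets of R^n *)

Section box.
Context (R : realType).

Definition box n (a : 'rV[R]_n) (r : R) : set 'rV[R]_n :=
  [set x | forall i, `|x ord0 i - a ord0 i| < r].

Lemma ball_box n (a : 'rV[R]_n) r : 0 < r -> ball a r = box a r.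
Proof.
move=> r0; apply/seteqP; split => x.
  by move=> [_ h] i; have := h ord0 i; rewrite -ball_normE /= distrC.
by move=> h; split => // i j; rewrite ord1 -ball_normE /= distrC.
Qed.

Lemma measurable_box n (a : 'rV[R]_n) r : measurable (box a r).
Proof.
rewrite (_ : box a r = \bigcap_(i in [set: 'I_n])
   ((fun x : 'rV[R]_n => x ord0 i : measurableTypeR R) @^-1` ball (a ord0 i) r));
       last first.
  apply/seteqP; split => x h i; first by move=> _; rewrite /= -ball_normE /= distrC;
      exact: h.
  by have := h i I; rewrite /= -ball_normE /= distrC.
apply: fin_bigcap_measurable; first exact: finite_finset.
move=> i _; rewrite -[X in measurable X]setTI; apply: measurable_rV_coord => //.
exact: measurable_ball.
Qed.

Lemma open_measurable_rV n (U : set 'rV[R]_n) : open U -> measurable U.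
Proof.
move=> oU.
(* Boxes with rational centres and radii [1/(k+1)] form a countable base. Those not contained in [U]
   are replaced by the empty set, so that the union runs over a whole countable type. *)
pose B (s : 'rV[rat]_n * nat) := box (map_mx ratr s.1 : 'rV[R]_n) s.2.+1%:R^-1.
rewrite (_ : U = \bigcup_s (if pselect (B s `<=` U) then B s else set0)); last first.
  apply/seteqP; split=> [x Ux|x [s _]]; last by case: pselect => // h /h.
  have /nbhs_ballP[e /= e0 eU] : nbhs x U by apply: open_nbhs_nbhs.
  (* A rational centre within [t] of [x] gives a box of radius [t] that contains [x] and stays
     within [2 * t < e] of it. *)
  have [k [t [tE t0 te]]] : exists k : nat, exists t : R, [/\ t = k.+1%:R^-1, 0 < t &
      t < e / 2].
    have /= [k _ hk] := near_infty_natSinv_lt (PosNum (divr_gt0 e0 (ltr0n R 2))).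
    by exists k, k.+1%:R^-1; split => //; exact: (hk k (leqnn k)).
  have /choice[q hq] : forall i, exists q : rat, `|x ord0 i - ratr q| < t.
    move=> i; have xx : x ord0 i - t < x ord0 i + t by lra.
    have [q] := rat_in_itvoo xx.
    by rewrite in_itv /= => qt; exists q; rewrite ltr_distlC.
  exists (\row_i q i, k) => //; rewrite /B /= -tE; case: pselect => [_ i|]; first by
      rewrite !mxE hq.
  case => y By; apply: eU; rewrite ball_box// => i.
  have := By i; have := hq i; rewrite !mxE /= => h1 h2.
  have := ler_distD (ratr (q i)) (y ord0 i) (x ord0 i).
  rewrite (distrC (ratr _)); lra.
apply: countable_bigcupT_measurable => //= s.
by case: pselect => h; [exact: measurable_box|exact: measurable0].
Qed.

Lemma closed_measurable_rV n (U : set 'rV[R]_n) : closed U -> measurable U.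
Proof.
by move=> cU; rewrite -(setCK U); apply: measurableC; apply: open_measurable_rV;
    exact: closed_openC.
Qed.

Lemma continuous_measurable_rV n (f : 'rV[R]_n -> R) :
  continuous f -> measurable_fun [set: 'rV[R]_n] (f : _ -> measurableTypeR R).
Proof.
move=> cf; apply: (measurability _ (RGenOpens.measurableE R)) => //.
move=> _ [_ [a [b ->] <-]]; rewrite setTI.
apply: open_measurable_rV; move/continuousP : cf; apply; exact: interval_open.
Qed.

Lemma rV_cons_coord0 n (z : measurableTypeR R * 'rV[R]_n) : rV_cons z ord0 ord0 = z.1.
Proof. by rewrite mxE unlift_none. Qed.

Lemma rV_cons_lift n (z : measurableTypeR R * 'rV[R]_n) j : rV_cons z ord0 (lift ord0
    j) = z.2 ord0 j.
Proof. by rewrite mxE liftK. Qed.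

Lemma preimage_rV_cons_box n (a : 'rV[R]_n.+1) r :
  @rV_cons R n @^-1` box a r =
  ball (a ord0 ord0) r `*` box (\row_j a ord0 (lift ord0 j)) r.
Proof.
apply/seteqP; split => [z h|z [h0 h] i].
  split; first by have := h ord0; rewrite rV_cons_coord0 -ball_normE /= distrC.
  by move=> i; have := h (lift ord0 i); rewrite rV_cons_lift mxE.
case: (unliftP ord0 i) => [j|] ->; last by rewrite rV_cons_coord0 distrC; move: h0;
    rewrite -ball_normE.
by rewrite rV_cons_lift; have := h j; rewrite mxE.
Qed.

(** This volume gives finiteness of the measure on compact sets, which lie in a box, and positivity
    on nonempty open sets, which contain one. *)
Lemma lebesgue_rV_box n (a : 'rV[R]_n) r : 0 < r ->
  lebesgue_rV R n (box a r) = ((r *+ 2) ^+ n)%:E.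
Proof.
move=> r0; elim: n a => [a|n IH a].
  by rewrite /= diracE mem_set// => -[].
rewrite /= /lebesgue_rV_succ /pushforward preimage_rV_cons_box.
rewrite product_measure1E; [|exact: measurable_ball|exact: measurable_box].
rewrite exprS EFinM -(IH (\row_j a ord0 (lift ord0 j))).
by congr (_ * _)%E; apply: lebesgue_measure_ball; exact: ltW.
Qed.

Lemma bounded_sub_box n (A : set 'rV[R]_n) : bounded_set A ->
  exists2 M, 0 < M & A `<=` box 0 M.
Proof.
move=> [M [_ hM]]; exists (`|M| + 2); first by have := normr_ge0 M; lra.
move=> x Ax i; rewrite mxE subr0.
have h : `|x| <= `|M| + 1 by apply: hM => //; have := ler_norm M; lra.
have := le_trans _ h => /(_ `|x ord0 i|).
rewrite /Num.norm /= mx_normrE.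
move=> /(_ (le_bigmax _ (fun ij => `|x ij.1 ij.2|) (ord0, i))) /=; lra.
Qed.

Lemma compact_sub_box n (A : set 'rV[R]_n) : compact A ->
  exists2 M, 0 < M & A `<=` box 0 M.
Proof. by move=> /compact_bounded/bounded_sub_box. Qed.

Lemma compact_norm_le n (M : R) : compact [set x : 'rV[R]_n | `|x| <= M].
Proof.
apply: bounded_closed_compact.
  by exists M; split; [exact: num_real|move=> N MN x /= xM; rewrite (le_trans xM)// ltW].
apply: (@closed_comp _ _ (fun x : 'rV[R]_n => `|x|) [set y | y <= M]); last exact:
    closed_le.
by move=> x _; exact: norm_continuous.
Qed.

Lemma box0_norm n (M : R) (x : 'rV[R]_n) : 0 < M -> box 0 M x -> `|x| <= M.
Proof.
by move=> M0; rewrite -ball_box// -ball_normE /= sub0r normrN => /ltW.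
Qed.

Lemma compact_measurable_rV n (A : set 'rV[R]_n) : compact A -> measurable A.
Proof.
move=> cA; apply: closed_measurable_rV; exact: compact_closed.
Qed.

Lemma compact_finite_measure_rV n (A : set 'rV[R]_n) :
  compact A -> (lebesgue_rV R n A < +oo)%E.
Proof.
move=> cA; have [M M0 AM] := compact_sub_box cA.
apply: (@le_lt_trans _ _ (lebesgue_rV R n (box 0 M))); last by rewrite
    lebesgue_rV_box// ltry.
by apply: le_measure => //; rewrite inE; [exact: compact_measurable_rV|exact:
    measurable_box].
Qed.

Lemma open_measure_gt0 n (U : set 'rV[R]_n) : open U -> U !=set0 ->
  (0 < lebesgue_rV R n U)%E.
Proof.
move=> oU [x Ux].
have /nbhs_ballP[e /= e0 eU] : nbhs x U by apply: open_nbhs_nbhs.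
apply: (@lt_le_trans _ _ (lebesgue_rV R n (box x e))).
  by rewrite lebesgue_rV_box// lte_fin exprn_gt0// mulrn_wgt0.
apply: le_measure; rewrite ?inE; [exact: measurable_box|exact: open_measurable_rV|].
by rewrite -ball_box.
Qed.

Lemma compact_support_bounded n (K : set 'rV[R]_n) (f : 'rV[R]_n -> R) :
  compact K -> continuous f -> (forall x, ~ K x -> f x = 0) ->
  exists2 C, 0 < C & forall x, `|f x| <= C.
Proof.
move=> cK cf f0.
have /compact_bounded[M [_ hM]] : compact (f @` K).
  by apply: continuous_compact => //; apply: continuous_subspaceT.
exists (`|M| + 1); first by have := normr_ge0 M; lra.
move=> x; have [Kx|/f0 ->] := pselect (K x); last by rewrite normr0; have :=
    normr_ge0 M; lra.
by apply: (hM (`|M| + 1)); [have := ler_norm M; lra|exists x].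
Qed.

(** The measure is arbitrary because this serves both for Lebesgue measure on R^n and for the
    product measure of which it is the pushforward. *)
Lemma bounded_support_integrable d (T : measurableType d) (mu : {measure set T -> \bar R})
    (K : set T) (f : T -> R) C :
  measurable K -> (mu K < +oo)%E -> measurable_fun [set: T] f ->
  (forall x, `|f x| <= C) -> (forall x, ~ K x -> f x = 0) ->
  mu.-integrable setT (EFin \o f).
Proof.
move=> mK Kfin mf fC f0.
apply: (@le_integrable _ _ _ _ _ measurableT _ (EFin \o (fun x => C * \1_K x))).
- exact/measurable_EFinP.
- move=> x _; rewrite /= lee_fin indicE.
  have C0 : 0 <= C by exact: le_trans (fC x).
  have [Kx|/f0 ->] := pselect (K x); last by rewrite normr0.
  by rewrite mem_set// mulr1 (ger0_norm C0).
- rewrite (_ : _ \o _ = fun x => (C%:E * (\1_K x)%:E)%E)//.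
  apply: integrableZl => //; apply/integrableP; split; first exact/measurable_EFinP.
  under eq_integral do rewrite gee0_abs ?lee_fin//.
  by rewrite integral_indic// setIT.
Qed.

Lemma compact_support_integrable n (K : set 'rV[R]_n) (f : 'rV[R]_n -> R) :
  compact K -> continuous f -> (forall x, ~ K x -> f x = 0) ->
  (lebesgue_rV R n).-integrable setT (EFin \o f).
Proof.
move=> cK cf f0; have [C _ fC] := compact_support_bounded cK cf f0.
apply: (bounded_support_integrable (K := K) (C := C)) => //.
- exact: compact_measurable_rV.
- exact: compact_finite_measure_rV.
- exact: continuous_measurable_rV.
Qed.

End box.

(** * Integration by parts *)

Section divergence.
Context (R : realType).

Lemma integral_derive_eq0 (g dg : R -> R) (M : R) : 0 < M ->
  (forall t, is_derive t (1 : R) g (dg t)) -> continuous dg ->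
  (forall t, M <= `|t| -> g t = 0 /\ dg t = 0) ->
  (\int[lebesgue_measure]_t (dg t)%:E)%E = 0%E.
Proof.
move=> M0 gdg cdg g0.
have cg : continuous g.
  by move=> t; apply/differentiable_continuous/derivable1_diffP; have [] := gdg t.
transitivity (\int[lebesgue_measure]_(t in [set` `[- M, M]%R]) (dg t)%:E)%E.
  rewrite [RHS]integral_mkcond; apply: eq_integral => t _; rewrite patchE.
  case: ifPn => //; rewrite notin_setE /= in_itv /= => /negP; rewrite -ler_norml
      -ltNge => /ltW.
  by move=> /g0[_ ->].
rewrite (continuous_FTC2 (F := g)).
- have [-> _] := g0 M (ler_norm _).
  have [-> _] := g0 (- M) ltac:(by rewrite normrN ler_norm).
  by rewrite subee.
- lra.
- exact: continuous_subspaceT.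
- split.
  + by move=> t _; have [] := gdg t.
  + by apply: cvg_at_right_filter; exact: cg.
  + by apply: cvg_at_left_filter; exact: cg.
- by move=> t _; rewrite derive1E; have [_ ->] := gdg t.
Qed.

Lemma continuous_rV_cons_l n (f : 'rV[R]_n.+1 -> R) (y : 'rV[R]_n) :
  continuous f -> continuous (fun t : R => f (rV_cons (t, y))).
Proof.
move=> cf t; apply: (@continuous_comp _ _ _ (fun t : R => rV_cons (t, y)) f); last
    exact: cf.
move=> A /nbhs_ballP[e /= e0 eA]; apply/nbhs_ballP; exists e => //= s ts.
apply: eA; rewrite ball_box// => i; case: (unliftP ord0 i) => [j|] ->.
  by rewrite !rV_cons_lift subrr normr0.
by rewrite !rV_cons_coord0 /= distrC; move: ts; rewrite -ball_normE.
Qed.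

Lemma continuous_rV_cons_r n (f : 'rV[R]_n.+1 -> R) (t : R) :
  continuous f -> continuous (fun y : 'rV[R]_n => f (rV_cons (t, y))).
Proof.
move=> cf y; apply: (@continuous_comp _ _ _ (fun y : 'rV[R]_n => rV_cons (t, y)) f);
    last exact: cf.
move=> A /nbhs_ballP[e /= e0 eA]; apply/nbhs_ballP; exists e => //= s ys.
apply: eA; move: ys; rewrite !ball_box// => h i; case: (unliftP ord0 i) => [j|] ->.
  by rewrite !rV_cons_lift; exact: h.
by rewrite !rV_cons_coord0 subrr normr0.
Qed.

Lemma rV_cons_line0 n (t h : R) (y : 'rV[R]_n) :
  h *: delta_mx ord0 ord0 + rV_cons (t, y) = rV_cons (h + t, y).
Proof.
apply/rowP => i; case: (unliftP ord0 i) => [j|] ->.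
  by rewrite mxE !rV_cons_lift !mxE /= mulr0 add0r.
by rewrite mxE !rV_cons_coord0 !mxE /= mulr1.
Qed.

Lemma rV_cons_line_lift n (t h : R) (y : 'rV[R]_n) j :
  h *: delta_mx ord0 (lift ord0 j) + rV_cons (t, y) = rV_cons (t, h *: delta_mx ord0
      j + y).
Proof.
apply/rowP => i; case: (unliftP ord0 i) => [k|] ->.
  by rewrite mxE !rV_cons_lift !mxE /= (inj_eq (@lift_inj _ ord0)).
by rewrite mxE !rV_cons_coord0 !mxE /= mulr0 add0r.
Qed.

(** A directional derivative sees only the values along its line. This turns a partial derivative on
    R^(n+1) into one of a slice, on R or on R^n. *)
Lemma is_derive_line (V W : normedModType R) (f : V -> R) (g : W -> R) (x v : V) (y w
    : W) df :
  (forall h : R, f (h *: v + x) = g (h *: w + y)) ->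
  is_derive x v f df -> is_derive y w g df.
Proof.
move=> fg [fx <-].
have E : (fun h : R => h^-1 *: ((f \o shift x) (h *: v) - f x)) =
         (fun h : R => h^-1 *: ((g \o shift y) (h *: w) - g y)).
  apply/funext => h /=; rewrite fg.
  by have := fg 0; rewrite !scale0r !add0r => ->.
by apply: DeriveDef; [move: fx; rewrite /derivable E|rewrite /derive E].
Qed.

(** Induction on the dimension, by Fubini. The support is confined to a box rather than to a general
    compact set because slices of boxes are again boxes with the same [M]. *)
Lemma integral_partial_eq0 n (i : 'I_n) (phi dphi : 'rV[R]_n -> R) M : 0 < M ->
  has_partial i phi dphi -> continuous dphi ->
  (forall x, ~ box 0 M x -> phi x = 0 /\ dphi x = 0) ->
  (\int[lebesgue_rV R n]_x (dphi x)%:E)%E = 0%E.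
Proof.
move=> M0; elim: n i phi dphi => [[]//|n IH] i phi dphi d c supp.
have [C _ dC] : exists2 C, 0 < C & forall x, `|dphi x| <= C.
  apply: (compact_support_bounded (@compact_norm_le R _ M)) => // x xM.
  by have [] // := supp x; move=> /(box0_norm M0).
have mf : measurable_fun setT (fun z => dphi (@rV_cons R n z)).
  apply: measurableT_comp; first exact: continuous_measurable_rV.
  exact: measurable_rV_cons.
have intf : (lebesgue_measure \x lebesgue_rV R n)%E.-integrable setT
    (EFin \o (fun z => dphi (@rV_cons R n z))).
  apply: (bounded_support_integrable (K := @rV_cons R n @^-1` box 0 M) (C := C)) => //.
  - rewrite -[X in measurable X]setTI; apply: measurable_rV_cons => //.
    exact: measurable_box.
  - have := lebesgue_rV_box (0 : 'rV[R]_n.+1) M0.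
    by rewrite /= /lebesgue_rV_succ /pushforward => ->; rewrite ltry.
  - by move=> z /supp[].
rewrite [LHS](_ : _ = \int[(lebesgue_measure \x lebesgue_rV R n)%E]_z (dphi (@rV_cons
    R n z))%:E)%E; last first.
  rewrite /= /lebesgue_rV_succ integral_pushforward//.
  by apply/measurable_EFinP; exact: continuous_measurable_rV.
have supp0 t y : M <= `|t| -> phi (rV_cons (t, y)) = 0 /\ dphi (rV_cons (t, y)) = 0.
  move=> tM; apply: supp => /(_ ord0); rewrite rV_cons_coord0 mxE subr0 /=.
  by rewrite ltNge tM.
have supp1 t y : ~ box 0 M y -> phi (rV_cons (t, y)) = 0 /\ dphi (rV_cons (t, y)) = 0.
  move=> tM; apply: supp => h; apply: tM => j.
  by have := h (lift ord0 j); rewrite rV_cons_lift !mxE.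
case: (unliftP ord0 i) d => [j|] -> d.
(* Direction among the last [n] coordinates: the first coordinate is frozen and the inner integral
   vanishes by induction. *)
- rewrite -integral12_prod_meas1// /fubini_F.
  under eq_integral => t _.
    rewrite (IH j (fun y => phi (rV_cons (t, y))) (fun y => dphi (rV_cons (t, y)))).
    + over.
    + move=> y; apply: is_derive_line (d (rV_cons (t, y))) => h.
      by rewrite rV_cons_line_lift.
    + exact: continuous_rV_cons_r.
    + exact: supp1.
  by rewrite integral0.
(* First direction: the last [n] coordinates are frozen and the fundamental theorem of calculus
   applies to the inner integral. *)
- rewrite -integral21_prod_meas1// /fubini_G.
  have inner y : (\int[lebesgue_measure]_t (dphi (rV_cons (t, y)))%:E)%E = 0%E.
    apply: (@integral_derive_eq0 (fun t => phi (rV_cons (t, y))) _ M) => //.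
    + move=> t; apply: is_derive_line (d (rV_cons (t, y))) => h.
      by rewrite rV_cons_line0 [_%:A]mulr1.
    + exact: continuous_rV_cons_l.
    + by move=> t; exact: supp0.
  by under eq_integral do rewrite inner; rewrite integral0.
Qed.

End divergence.

(** * L^p estimates *)

Section Lnorm_estimates.
Context d (T : measurableType d) (R : realType) (mu : {measure set T -> \bar R}).
Context (p : R) (p1 : 1 <= p).
Implicit Types f g h k : T -> R.
Local Notation N f := ('N[mu]_p%:E[EFin \o f%R])%E.

Let p0 : 0 < p. Proof. exact: lt_le_trans p1. Qed.

Lemma measurable_norm_powR f : measurable_fun setT f ->
  measurable_fun setT (fun x => `|f x| `^ p).
Proof.
move=> mf; apply: (measurableT_comp (measurable_powR _)).
exact: measurableT_comp.
Qed.

Lemma Lnorm_EFinE f : N f = ((\int[mu]_x (`|f x| `^ p)%:E) `^ p^-1)%E.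
Proof. by rewrite unlock. Qed.

Lemma le_Lnorm f g : measurable_fun setT f -> measurable_fun setT g ->
  (forall x, `|f x| <= `|g x|) -> (N f <= N g)%E.
Proof.
move=> mf mg fg; rewrite !Lnorm_EFinE; apply: gt0_ler_poweR; rewrite ?invr_ge0 ?(ltW
    p0)//.
1,2: by rewrite in_itv /= leey andbT integral_ge0// => x _; rewrite lee_fin powR_ge0.
apply: ge0_le_integral => //.
- by apply/measurable_EFinP; exact: measurable_norm_powR.
- by apply/measurable_EFinP; exact: measurable_norm_powR.
- by move=> x _; rewrite lee_fin ge0_ler_powR ?nnegrE// ltW.
Qed.

Lemma Lnorm_scale (c : R) f : 0 <= c -> measurable_fun setT f ->
  N (fun x => c * f x) = (c%:E * N f)%E.
Proof.
move=> c0 mf; rewrite !Lnorm_EFinE.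
under eq_integral do rewrite normrM powRM// (ger0_norm c0) EFinM.
rewrite ge0_integralZl//; last 2 first.
- by apply/measurable_EFinP; exact: measurable_norm_powR.
- by rewrite lee_fin powR_ge0.
rewrite poweRM ?lee_fin ?powR_ge0//; last first.
  by apply: integral_ge0 => x _; rewrite lee_fin powR_ge0.
by rewrite poweR_EFin -powRrM divff ?gt_eqF// powRr1.
Qed.

(** Minkowski's inequality with a pointwise hypothesis: later estimates expand a difference
    pointwise, bound the coefficients by constants and pass to norms in one step. *)
Lemma le_LnormD f g h (a b : R) : 0 <= a -> 0 <= b -> measurable_fun setT f ->
  measurable_fun setT g -> measurable_fun setT h ->
  (forall x, `|f x| <= a * `|g x| + b * `|h x|) ->
  (N f <= a%:E * N g + b%:E * N h)%E.
Proof.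
move=> a0 b0 mf mg mh fgh.
have mg' : measurable_fun setT (fun x => `|g x|) by exact: measurableT_comp.
have mh' : measurable_fun setT (fun x => `|h x|) by exact: measurableT_comp.
have Nn k : N (fun x => `|k x|) = N k.
  by rewrite !Lnorm_EFinE; under eq_integral do rewrite normr_id.
have mg2 : measurable_fun setT (fun x => a * `|g x|) by exact: measurable_funM.
have mh2 : measurable_fun setT (fun x => b * `|h x|) by exact: measurable_funM.
apply: (@le_trans _ _ (N ((fun x => a * `|g x|) \+ (fun x => b * `|h x|))%R)).
  apply: le_Lnorm => //; first exact: measurable_funD.
  by move=> x; rewrite [leRHS]ger0_norm// addr_ge0// mulr_ge0.
apply: (le_trans (minkowski_EFin _ mg2 mh2 p1)).
by rewrite !Lnorm_scale// !Nn.
Qed.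

Lemma le_LnormD3 f g h k (a b c : R) : 0 <= a -> 0 <= b -> 0 <= c -> measurable_fun
    setT f ->
  measurable_fun setT g -> measurable_fun setT h -> measurable_fun setT k ->
  (forall x, `|f x| <= a * `|g x| + b * `|h x| + c * `|k x|) ->
  (N f <= a%:E * N g + b%:E * N h + c%:E * N k)%E.
Proof.
move=> a0 b0 c0 mf mg mh mk fgh.
have mn (u : T -> R) : measurable_fun setT u -> measurable_fun setT (fun x => `|u x|).
  by move=> mu'; exact: measurableT_comp.
have mgh : measurable_fun setT (fun x => a * `|g x| + b * `|h x|).
  by apply: measurable_funD; apply: measurable_funM => //; exact: mn.
apply: (@le_trans _ _ (1%:E * N (fun x => a * `|g x| + b * `|h x|) + c%:E * N k)%E).
  apply: le_LnormD => // x; rewrite mul1r.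
  by rewrite [X in _ <= X + _]ger0_norm// addr_ge0// mulr_ge0.
apply: leeD => //; rewrite mul1e; apply: le_LnormD => // x.
by rewrite ger0_norm// addr_ge0// mulr_ge0.
Qed.

Lemma Lnorm_lty f : (N f < +oo)%E = (\int[mu]_x (`|f x| `^ p)%:E < +oo)%E.
Proof.
rewrite Lnorm_EFinE; apply/idP/idP; last exact: poweR_lty.
by apply: lty_poweRy; rewrite invr_eq0 gt_eqF.
Qed.

Lemma in_LfunP f : f \in Lfun mu p%:E <-> measurable_fun setT f /\ (N f < +oo)%E.
Proof.
rewrite inE /=; split => [/andP[]|[mf fo]]; first by rewrite !inE.
by apply/andP; split; rewrite inE.
Qed.

Lemma bounded_support_Lnorm_lty (K : set T) f C : measurable K -> (mu K < +oo)%E ->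
  measurable_fun setT f -> (forall x, `|f x| <= C) ->
  (forall x, ~ K x -> f x = 0) -> (N f < +oo)%E.
Proof.
move=> mK Kfin mf fC f0; rewrite Lnorm_lty.
have : mu.-integrable setT (EFin \o (fun x => `|f x| `^ p)).
  apply: (bounded_support_integrable (K := K) (C := C `^ p)) => //.
  - exact: measurable_norm_powR.
  - move=> x; rewrite ger0_norm ?powR_ge0// ge0_ler_powR ?nnegrE ?(ltW p0)//.
    exact: le_trans (fC x).
  - by move=> x /f0 ->; rewrite normr0 powR0// gt_eqF.
move/integrableP => [_]; apply: le_lt_trans.
rewrite le_eqVlt; apply/orP; left; apply/eqP/eq_integral => x _.
by rewrite /= (ger0_norm (powR_ge0 _ _)).
Qed.

End Lnorm_estimates.

Section hoelder_pairing.
Context d (T : measurableType d) (R : realType) (mu : {measure set T -> \bar R}).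
Context (p q : R) (p0 : 0 < p) (q0 : 0 < q) (pq : p^-1 + q^-1 = 1).
Implicit Types f g : T -> R.

Lemma hoelder_integrable f g : measurable_fun setT f -> measurable_fun setT g ->
  ('N[mu]_p%:E[EFin \o f] < +oo)%E -> ('N[mu]_q%:E[EFin \o g] < +oo)%E ->
  mu.-integrable setT (fun x => (f x * g x)%:E).
Proof.
move=> mf mg Nf Ng; apply/integrableP; split.
  by apply/measurable_EFinP; exact: measurable_funM.
have h := hoelder mu mf mg p0 q0 pq; rewrite Lnorm1 in h; apply: (le_lt_trans h).
by apply: lte_mul_pinfty; rewrite ?ge0_fin_numE ?Lnorm_ge0.
Qed.

Lemma le_Rintegral_hoelder f g : measurable_fun setT f -> measurable_fun setT g ->
  ('N[mu]_p%:E[EFin \o f] < +oo)%E -> ('N[mu]_q%:E[EFin \o g] < +oo)%E ->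
  ((`|\int[mu]_x (f x * g x)|%R)%:E <=
   'N[mu]_p%:E[EFin \o f] * 'N[mu]_q%:E[EFin \o g])%E.
Proof.
move=> mf mg Nf Ng; apply: (le_trans _ (hoelder mu mf mg p0 q0 pq)).
rewrite Lnorm1.
have ifg := hoelder_integrable mf mg Nf Ng.
have /integrableP[_ ifg'] := ifg.
rewrite -[leRHS]fineK; last by rewrite ge0_fin_numE// integral_ge0.
rewrite lee_fin; exact: le_normr_Rintegral.
Qed.

End hoelder_pairing.

Lemma cvge0P (R : realType) (u : nat -> \bar R) : (forall k, 0 <= u k)%E ->
  u k @[k --> \oo] --> 0%E <->
  (forall e : R, 0 < e -> \forall k \near \oo, (u k < e%:E)%E).
Proof.
move=> u0; split => [cu e e0|h].
  have : nbhs (0%E : \bar R) [set x | (x < e%:E)%E].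
    by apply: open_nbhs_nbhs; split; [exact: open_ereal_lt_ereal|rewrite /= lte_fin].
  exact: cu.
move=> A /= [e /= e0 eA]; suff : \forall k \near \oo, A (u k) by [].
apply: filterS (h e e0) => k; move: (u0 k); case E : (u k) => [r| |] //; rewrite
    lee_fin lte_fin => r0 re.
by apply: eA => /=; rewrite sub0r normrN ger0_norm.
Qed.

(** * Test functions *)

Section smooth_support.
Context (R : realType) (n : nat).
Implicit Types (U : set 'rV[R]_n) (phi psi : 'rV[R]_n -> R).
Local Notation mu := (lebesgue_rV R n).

(** The complement of [K] is open, so near such an [x] the difference quotients are zero. *)
Lemma has_partial_eq0 i (K : set 'rV[R]_n) phi dphi x : closed K ->
  (forall x, ~ K x -> phi x = 0) -> has_partial i phi dphi -> ~ K x -> dphi x = 0.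
Proof.
move=> cK phi0 d Kx; have [_ <-] := d x.
have oK : nbhs x (~` K) by apply: open_nbhs_nbhs; split => //; exact: closed_openC.
have cl : (h *: delta_mx ord0 i + x) @[h --> (0:R)] --> x.
  rewrite -[X in _ --> X]add0r -(scale0r (delta_mx ord0 i)).
  by apply: cvgD; [apply: cvgZr_tmp; exact: cvg_id|exact: cvg_cst].
apply: lim_near_cst; first exact: Rhausdorff.
have := cl _ oK; rewrite nbhs_simpl /= => hnear.
near=> h.
have : (~` K) (h *: delta_mx ord0 i + x) by near: h; apply: nbhs_dnbhs.
by move=> /phi0 /= ->; rewrite phi0// subrr scaler0.
Unshelve. all: by end_near.
Qed.

(** The form in which test functions are used from here on: a single compact [K] serves for the
    function and for all its first partial derivatives. *)
Lemma Cc_support U phi : Cc_infty U phi -> exists K,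
  [/\ compact K, K `<=` U, (forall x, ~ K x -> phi x = 0) &
      forall i x, ~ K x -> partial i phi x = 0].
Proof.
move=> [Cphi cK KU]; exists (closure [set x | phi x != 0]).
have phi0 x : ~ closure [set x | phi x != 0] x -> phi x = 0.
  by move=> nKx; apply/eqP/negP => /negP px; apply: nKx; exact: subset_closure.
split => [//|//|//|i x nKx].
exact: (has_partial_eq0 (@closed_closure _ _) phi0 (CnS_has_partial i (Cphi 1%N))).
Qed.

Lemma Cc_continuous U phi : Cc_infty U phi -> continuous phi.
Proof. by move=> [/(_ 0%N) h _ _]; exact: Cn_continuous h. Qed.

Lemma Cc_continuous_partial U phi i : Cc_infty U phi -> continuous (partial i phi).
Proof. by move=> [/(_ 1%N)[_ /(_ i)[_ h]] _ _]; exact: (@Cn_continuous _ _ 0%N _ h). Qed.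

Lemma Cc_bounded U phi : Cc_infty U phi -> exists2 C, 0 < C & forall x, `|phi x| <= C.
Proof.
move=> h; have [K [cK _ p0 _]] := Cc_support h.
exact: compact_support_bounded cK (Cc_continuous h) p0.
Qed.

Lemma Cc_bounded_partial U phi i : Cc_infty U phi ->
  exists2 C, 0 < C & forall x, `|partial i phi x| <= C.
Proof.
move=> h; have [K [cK _ _ p0]] := Cc_support h.
exact: (compact_support_bounded cK (Cc_continuous_partial h) (p0 i)).
Qed.

Lemma Cc_intro U phi K : (forall k, Cn k phi) -> compact K -> K `<=` U ->
  (forall x, ~ K x -> phi x = 0) -> Cc_infty U phi.
Proof.
move=> Cphi cK KU phi0.
have sub : closure [set x | phi x != 0] `<=` K.
  rewrite [X in _ `<=` X](closure_id K).1; last exact: compact_closed.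
  by apply: closure_subset => x /= px; apply: contrapT => /phi0 /eqP; exact/negP.
split => //; last exact: subset_trans sub KU.
by apply: (subclosed_compact _ cK) => //; exact: closed_closure.
Qed.

Lemma Cc_Lnorm_lty U phi p : 1 <= p -> Cc_infty U phi ->
  ('N[mu]_p%:E[EFin \o phi] < +oo)%E.
Proof.
move=> p1 h; have [K [cK _ p0 _]] := Cc_support h; have [C _ hC] := Cc_bounded h.
apply: (bounded_support_Lnorm_lty p1 (K := K) (C := C)) => //.
- exact: compact_measurable_rV.
- exact: compact_finite_measure_rV.
- by apply: continuous_measurable_rV; exact: Cc_continuous h.
Qed.

Lemma Cc_Lnorm_partial_lty U phi p i : 1 <= p -> Cc_infty U phi ->
  ('N[mu]_p%:E[EFin \o partial i phi] < +oo)%E.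
Proof.
move=> p1 h; have [K [cK _ _ p0]] := Cc_support h; have [C _ hC] :=
    Cc_bounded_partial i h.
apply: (bounded_support_Lnorm_lty p1 (K := K) (C := C)) => //.
- exact: compact_measurable_rV.
- exact: compact_finite_measure_rV.
- by apply: continuous_measurable_rV; exact: Cc_continuous_partial h.
- exact: p0.
Qed.

Lemma Rintegral_patchM U (u h : 'rV[R]_n -> R) : (forall x, ~ U x -> h x = 0) ->
  \int[mu]_(x in U) (u x * h x) = \int[mu]_x ((u \_ U) x * h x).
Proof.
move=> h0; rewrite Rintegral_mkcond; apply: eq_Rintegral => x _.
rewrite !patchE; case: ifPn => //; rewrite notin_setE => /h0 ->.
by rewrite mulr0.
Qed.

(** The product [phi * eta] has compact support, so its partial derivative has integral zero. *)
Lemma Cc_integration_by_parts U V phi eta i : Cc_infty U phi -> Cc_infty V eta ->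
  \int[mu]_x (phi x * partial i eta x) = - \int[mu]_x (partial i phi x * eta x).
Proof.
move=> hphi heta.
have [K [cK KU p0 dp0]] := Cc_support hphi.
have [M M0 KM] := compact_sub_box cK.
have c1 := Cc_continuous hphi; have c2 := Cc_continuous heta.
have c1' := Cc_continuous_partial (i := i) hphi; have c2' := Cc_continuous_partial (i
    := i) heta.
have ca : continuous (fun x => phi x * partial i eta x).
  by move=> x; exact: (continuousM (c1 x) (c2' x)).
have cb : continuous (fun x => eta x * partial i phi x).
  by move=> x; exact: (continuousM (c2 x) (c1' x)).
have d : has_partial i (fun x => phi x * eta x) (fun x => phi x * partial i eta x +
    eta x * partial i phi x).
  by apply: has_partialM; [case: hphi => /(_ 1%N) h _ _|case: heta => /(_ 1%N) h _
      _]; exact: CnS_has_partial h.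
have ia : mu.-integrable setT (EFin \o (fun x => phi x * partial i eta x)).
  by apply: (compact_support_integrable cK) => // x /p0 ->; rewrite mul0r.
have ib : mu.-integrable setT (EFin \o (fun x => eta x * partial i phi x)).
  by apply: (compact_support_integrable cK) => // x /dp0 ->; rewrite mulr0.
have h : (\int[mu]_x (phi x * partial i eta x + eta x * partial i phi x)%:E = 0)%E.
  apply: (integral_partial_eq0 M0 d) => [x|x bx]; first exact: (continuousD (ca x)
      (cb x)).
  by have Kx := contra_not (KM x) bx; rewrite p0// dp0// !(mul0r, mulr0) addr0.
rewrite [X in - X](_ : _ = \int[mu]_x (eta x * partial i phi x)); last first.
  by apply: eq_Rintegral => x _; rewrite mulrC.
by apply/eqP; rewrite -addr_eq0 -RintegralD// /Rintegral h.
Qed.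

End smooth_support.

(** * The space W_0^{1,p} *)

Section sobolev_limits.
Context (R : realType) (n : nat) (p : R) (p1 : 1 < p).
Implicit Types (U : set 'rV[R]_n) (phi psi u : 'rV[R]_n -> R) (g : 'rV[R]_n -> 'rV[R]_n).
Local Notation mu := (lebesgue_rV R n).
Local Notation N f := ('N[mu]_p%:E[EFin \o f%R])%E.

Lemma Lp_cvgP U (u_ : nat -> 'rV[R]_n -> R) u : Lp_cvg p U u_ u <->
  (forall e : R, 0 < e -> \forall k \near \oo, (N ((u_ k \- u)%R \_ U) < e%:E)%E).
Proof. by apply: cvge0P => k; exact: Lnorm_ge0. Qed.

Lemma patch_Cc U phi : Cc_infty U phi -> phi \_ U = phi.
Proof.
move=> h; have [K [_ KU p0 _]] := Cc_support h; apply/funext => x; rewrite patchE.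
by case: ifPn => //; rewrite notin_setE => Ux; rewrite p0// => /KU.
Qed.

Lemma patch_partial_Cc U phi i : Cc_infty U phi -> partial i phi \_ U = partial i phi.
Proof.
move=> h; have [K [_ KU _ p0]] := Cc_support h; apply/funext => x; rewrite patchE.
by case: ifPn => //; rewrite notin_setE => Ux; rewrite p0// => /KU.
Qed.

Lemma patch_sub U phi psi : (phi \- psi) \_ U = (phi \_ U) \- (psi \_ U).
Proof. by apply/funext => x; rewrite /= !patchE; case: ifPn; rewrite ?subr0. Qed.

Lemma measurable_Cc U phi : Cc_infty U phi -> measurable_fun setT (phi : _ ->
    measurableTypeR R).
Proof. by move=> h; apply: continuous_measurable_rV; exact: Cc_continuous h. Qed.

Lemma measurable_Cc_partial U phi i : Cc_infty U phi ->
  measurable_fun setT (partial i phi : _ -> measurableTypeR R).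
Proof. by move=> h; apply: continuous_measurable_rV; exact: Cc_continuous_partial h. Qed.

Lemma eq0_of_le_mul (a c : R) : 0 <= c -> (forall e, 0 < e -> `|a| <= e * c) -> a = 0.
Proof.
move=> c0 h; apply/eqP; rewrite -normr_le0; apply/ler_addgt0Pr => e e0; rewrite add0r.
have c1 : 0 < c + 1 by lra.
apply: (le_trans (h _ (divr_gt0 e0 c1))).
by rewrite -mulrA ler_piMr ?(ltW e0)// mulrC ler_pdivrMr// mul1r; lra.
Qed.

(** Reduces membership in W_0^{1,p} to measurability and L^p convergence. The limit is in L^p
    because one approximation is and the distance to it is finite; the weak gradient identity holds
    for each test function [xi_ k] and passes to the limit by Hoelder's inequality against [eta] and
    its derivative. *)
Lemma W01p_limit U (xi_ : nat -> 'rV[R]_n -> R) (xi : 'rV[R]_n -> R) (dxi : 'rV[R]_n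
    -> 'rV[R]_n) :
  measurable_fun setT (xi \_ U) ->
  (forall i, measurable_fun setT ((fun x => dxi x ord0 i) \_ U)) ->
  (forall k, Cc_infty U (xi_ k)) -> Lp_cvg p U xi_ xi ->
  (forall i, Lp_cvg p U (fun k => partial i (xi_ k)) (fun x => dxi x ord0 i)) ->
  W01p p U xi dxi.
Proof.
move=> mxi mdxi hxi /Lp_cvgP cxi hd.
have cdxi i := (Lp_cvgP _ _ _).1 (hd i).
have LpU (v_ : nat -> 'rV[R]_n -> R) v : measurable_fun setT (v \_ U) ->
    (forall k, measurable_fun setT (v_ k \_ U)) -> (forall k, N (v_ k \_ U) < +oo)%E ->
    (forall e : R, 0 < e -> \forall k \near \oo, (N ((v_ k \- v)%R \_ U) < e%:E)%E)
        -> Lp p U v.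
  move=> mv mv_ Nv_ cv; apply/in_LfunP; split => //.
  have [k _ /(_ k (leqnn k)) /= hk] := cv 1 ltr01.
  apply: (@le_lt_trans _ _ (1%:E * N (v_ k \_ U) + 1%:E * N ((v_ k \- v)%R \_ U))%E).
    apply: (le_LnormD mu (ltW p1)) => //.
      by rewrite patch_sub; exact: measurable_funB.
    move=> x; rewrite patch_sub /= !mul1r.
    by have := ler_normB ((v_ k \_ U) x) ((v_ k \_ U) x - (v \_ U) x); rewrite opprB
        addrC subrK.
  by rewrite !mul1e lte_add_pinfty// (lt_trans hk)// ltry.
have Lxi : Lp p U xi.
  apply: (LpU xi_) => // k; rewrite patch_Cc//; first exact: measurable_Cc (hxi k).
  exact: Cc_Lnorm_lty (ltW p1) (hxi k).
have Ldxi i : Lp p U (fun x => dxi x ord0 i).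
  apply: (LpU (fun k => partial i (xi_ k))) => [//|k|k|]; last exact: cdxi.
    by rewrite patch_partial_Cc//; exact: measurable_Cc_partial (hxi k).
  by rewrite patch_partial_Cc//; exact: Cc_Lnorm_partial_lty (ltW p1) (hxi k).
split; last by exists xi_; split => //; apply/Lp_cvgP.
split => // eta heta i.
have [K [cK KU e0 de0]] := Cc_support heta.
rewrite Rintegral_patchM; last by move=> x Ux; apply: de0 => /KU.
rewrite [in RHS]Rintegral_patchM; last by move=> x Ux; apply: e0 => /KU.
pose q := p / (p - 1).
have p0 : 0 < p by exact: lt_trans ltr01 p1.
have pm1 : 0 < p - 1 by rewrite subr_gt0.
have q0 : 0 < q by rewrite divr_gt0.
have q1 : 1 <= q by rewrite ler_pdivlMr// mul1r gerBl.
have pq : p^-1 + q^-1 = 1 by rewrite /q; field; rewrite !gt_eqF.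
have Nh := Cc_Lnorm_partial_lty i q1 heta; have Ne := Cc_Lnorm_lty q1 heta.
have mh := measurable_Cc_partial i heta; have me := measurable_Cc heta.
have Nxi := ((in_LfunP mu p _).1 Lxi).2.
have Ndxi := ((in_LfunP mu p _).1 (Ldxi i)).2.
apply/eqP; rewrite -subr_eq0 opprK; apply/eqP.
set c1 := ('N[mu]_q%:E[EFin \o partial i eta])%E in Nh.
set c2 := ('N[mu]_q%:E[EFin \o eta])%E in Ne.
have Ec1 : c1 = (fine c1)%:E by rewrite fineK// ge0_fin_numE// Lnorm_ge0.
have Ec2 : c2 = (fine c2)%:E by rewrite fineK// ge0_fin_numE// Lnorm_ge0.
apply: (@eq0_of_le_mul _ (fine c1 + fine c2)).
  by rewrite addr_ge0// fine_ge0// Lnorm_ge0.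
move=> e e_gt0.
(* One index [k] for which both the function and its derivative are [e]-close in L^p. *)
have [k _ /(_ k (leqnn k)) /= [hk hdk]] : \forall k \near \oo,
    (N ((xi_ k \- xi)%R \_ U) < e%:E)%E /\
    (N ((partial i (xi_ k) \- (fun x => dxi x ord0 i))%R \_ U) < e%:E)%E.
  near=> k; split; near: k; [exact: cxi|exact: cdxi].
have Nxk := Cc_Lnorm_lty (ltW p1) (hxi k).
have Ndxk := Cc_Lnorm_partial_lty i (ltW p1) (hxi k).
have mxk := measurable_Cc (hxi k); have mdxk := measurable_Cc_partial i (hxi k).
rewrite !patch_sub patch_Cc// patch_partial_Cc// in hk hdk.
have i1 := hoelder_integrable p0 q0 pq mxk mh Nxk Nh.
have i2 := hoelder_integrable p0 q0 pq mdxk me Ndxk Ne.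
have i3 := hoelder_integrable p0 q0 pq mxi mh Nxi Nh.
have i4 := hoelder_integrable p0 q0 pq (mdxi i) me Ndxi Ne.
have E1 : \int[mu]_x ((xi_ k x - (xi \_ U) x) * partial i eta x) =
    \int[mu]_x (xi_ k x * partial i eta x) - \int[mu]_x ((xi \_ U) x * partial i eta x).
  by rewrite -RintegralB//; apply: eq_Rintegral => x _; rewrite mulrBl.
have E2 : \int[mu]_x ((partial i (xi_ k) x - ((fun x => dxi x ord0 i) \_ U) x) * eta x) =
    \int[mu]_x (partial i (xi_ k) x * eta x) - \int[mu]_x (((fun x => dxi x ord0 i)
        \_ U) x * eta x).
  by rewrite -RintegralB//; apply: eq_Rintegral => x _; rewrite mulrBl.
have E3 := Cc_integration_by_parts i (hxi k) heta.
have H1 := le_Rintegral_hoelder p0 q0 pq (measurable_funB mxk mxi) mh (lt_trans hk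
    (ltry _)) Nh.
have H2 := le_Rintegral_hoelder p0 q0 pq (measurable_funB mdxk (mdxi i)) me (lt_trans
    hdk (ltry _)) Ne.
have B1 : `|\int[mu]_x ((xi_ k x - (xi \_ U) x) * partial i eta x)| <= e * fine c1.
  rewrite -lee_fin; apply: (le_trans H1); rewrite -/c1 Ec1 EFinM.
  by apply: lee_wpmul2r; [rewrite lee_fin fine_ge0// Lnorm_ge0|exact: ltW].
have B2 : `|\int[mu]_x ((partial i (xi_ k) x - ((fun x => dxi x ord0 i) \_ U) x) *
    eta x)| <= e * fine c2.
  rewrite -lee_fin; apply: (le_trans H2); rewrite -/c2 Ec2 EFinM.
  by apply: lee_wpmul2r; [rewrite lee_fin fine_ge0// Lnorm_ge0|exact: ltW].
(* Since the identity holds exactly for [xi_ k], the defect for [xi] is minus the sum of the two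
   integrals bounded in [B1] and [B2]. *)
rewrite mulrDr; apply: le_trans (lerD B1 B2); apply: le_trans (ler_normD _ _).
rewrite E1 E2 E3 -[leLHS]normrN; rewrite le_eqVlt; apply/orP; left; apply/eqP; congr
    Num.norm.
ring.
Unshelve. all: by end_near.
Qed.

Lemma Lp_measurable U u : Lp p U u -> measurable_fun setT (u \_ U).
Proof. by move=> /in_LfunP[]. Qed.

Lemma W01p_Cc U phi : Cc_infty U phi -> W01p p U phi (fun x => \row_i partial i phi x).
Proof.
move=> h.
have rowE i : (fun x => (\row_i partial i phi x) ord0 i) = partial i phi.
  by apply/funext => x; rewrite mxE.
have cvg0 (v : 'rV[R]_n -> R) : Lp_cvg p U (fun=> v) v.
  apply/Lp_cvgP => e e0; apply: nearW => k.
  rewrite (_ : (v \- v) \_ U = cst 0); last first.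
    by apply/funext => x; rewrite patchE /= subrr if_same.
  have p_neq0 : (p%:E != 0)%E by rewrite eqe gt_eqF// (lt_trans ltr01).
  by rewrite [X in Lnorm _ _ X](_ : _ = cst 0%E)// Lnorm0// lte_fin.
apply: (W01p_limit (xi_ := fun=> phi)) => // [|i|i].
- by rewrite patch_Cc//; exact: measurable_Cc h.
- by rewrite rowE patch_partial_Cc//; exact: measurable_Cc_partial h.
- by rewrite rowE; exact: cvg0.
Qed.

End sobolev_limits.

Lemma bounded_derive_lipschitz (R : realType) (G G1 : R -> R) (C : R) :
  (forall x, is_derive x (1 : R) G (G1 x)) -> (forall x, `|G1 x| <= C) ->
  forall x y, `|G x - G y| <= C * `|x - y|.
Proof.
move=> dG bG.
have cG : continuous G.
  by move=> t; apply/differentiable_continuous/derivable1_diffP; have [] := dG t.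
suff h x y : x <= y -> `|G x - G y| <= C * `|x - y|.
  move=> x y; have [/h//|/ltW/h] := leP x y.
  by rewrite distrC (distrC y).
move=> xy; have [c _ Gxy] := MVT_segment xy (fun z _ => dG z) (continuous_subspaceT cG).
by rewrite distrC Gxy normrM (distrC x) ler_wpM2r.
Qed.

(** * Test functions multiplied by smooth functions of a Sobolev function *)

Section sobolev_product.
Context (R : realType) (n : nat) (p : R) (p1 : 1 < p).
Local Notation mu := (lebesgue_rV R n).
Local Notation N f := ('N[mu]_p%:E[EFin \o f%R])%E.

(** This makes the Picone test function admissible. If test functions [w k] converge to [u], then
    [a * G (w k)] are test functions converging to [a * G u]. [CG] keeps them smooth; the bounds on
    [G1] and its Lipschitz constant control the gradients. *)
Lemma W01p_mul_comp (U : set 'rV[R]_n) (u : 'rV[R]_n -> R) (g : 'rV[R]_n -> 'rV[R]_n)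
    (a : 'rV[R]_n -> R) (G G1 : R -> R) (C : R) :
  W01p p U u g -> Cc_infty U a ->
  (forall k phi, @Cn R n k phi -> Cn k (fun x => G (phi x))) ->
  (forall x, is_derive x (1 : R) G (G1 x)) -> continuous G1 ->
  (forall x, `|G x| <= C) -> (forall x, `|G1 x| <= C) ->
  (forall x y, `|G1 x - G1 y| <= C * `|x - y|) ->
  W01p p U (fun x => a x * G (u x))
    (fun x => \row_i (partial i a x * G (u x) + a x * G1 (u x) * g x ord0 i)).
Proof.
move=> [[Lu Lg _] [w [hw cw cdw]]] ha CG dG cG1 bG bG1 lG1.
have lG := bounded_derive_lipschitz dG bG1.
have C0 : 0 <= C by exact: le_trans (bG 0).
have mG : measurable_fun setT G.
  apply: continuous_measurable_fun => t.
  by apply/differentiable_continuous/derivable1_diffP; have [] := dG t.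
have mG1 : measurable_fun setT G1 by exact: continuous_measurable_fun.
have [A A0 bA] := Cc_bounded ha.
have mu_ := Lp_measurable Lu; have mg i := Lp_measurable (Lg i).
have a0 x : ~ U x -> a x = 0.
  by have [K [_ KU h _]] := Cc_support ha; move=> Ux; apply: h => /KU.
have da0 i x : ~ U x -> partial i a x = 0.
  by have [K [_ KU _ h]] := Cc_support ha; move=> Ux; apply: h => /KU.
have ma := measurable_Cc ha; have mda i := measurable_Cc_partial i ha.
have mw k := measurable_Cc (hw k); have mdw k i := measurable_Cc_partial i (hw k).
(* Outside [U] the values of [u] are arbitrary, but [a] vanishes there, so [u] may be replaced by
   its extension by zero, which is measurable on the whole space. *)
have xiE : (fun x => a x * G (u x)) \_ U = (fun x => a x * G ((u \_ U) x)).
  apply/funext => x; rewrite !patchE; case: ifPn => //; rewrite notin_setE => /a0 ->.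
  by rewrite mul0r.
have dxiE i : (fun x => (\row_j (partial j a x * G (u x) + a x * G1 (u x) * g x ord0
    j)) ord0 i) \_ U
    = (fun x => partial i a x * G ((u \_ U) x) + a x * G1 ((u \_ U) x) * ((fun x => g
        x ord0 i) \_ U) x).
  apply/funext => x; rewrite !patchE; case: ifPn; first by rewrite mxE.
  by rewrite notin_setE => Ux; rewrite a0// da0// !mul0r addr0.
have mxi : measurable_fun setT (fun x => a x * G ((u \_ U) x)).
  by apply: measurable_funM => //; exact: measurableT_comp.
have mdxi i : measurable_fun setT (fun x => partial i a x * G ((u \_ U) x) + a x * G1
    ((u \_ U) x) * ((fun x => g x ord0 i) \_ U) x).
  by do ![apply: measurable_funD|apply: measurable_funM|exact:
      measurableT_comp|exact: mda|exact: mg|exact: ma].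
pose xi_ k x := a x * G (w k x).
have dxi_ k i : partial i (xi_ k) = (fun x => a x * (G1 (w k x) * partial i (w k) x)
    + G (w k x) * partial i a x).
  apply: has_partial_eq; apply: has_partialM; first by case: ha => /(_ 1%N) h _ _;
      exact: CnS_has_partial h.
  apply: has_partial_comp => //.
  by have [/(_ 1%N) h _ _] := hw k; exact: CnS_has_partial h.
have hxi k : Cc_infty U (xi_ k).
  have [K [cK KU h _]] := Cc_support ha.
  apply: (Cc_intro (K := K)) => // [j|x Kx]; last by rewrite /xi_ h// mul0r.
  apply: CnM; first by case: ha.
  by apply: CG; case: (hw k).
apply: (W01p_limit p1 (xi_ := xi_)) => //.
- by rewrite xiE.
- by move=> i; rewrite dxiE.
- apply/Lp_cvgP => e e0.
  have AC0 : 0 < A * C + 1 by rewrite ltr_wpDl// mulr_ge0// ltW.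
  move/Lp_cvgP : cw => /(_ _ (divr_gt0 e0 AC0)); apply: filterS => k hk.
  rewrite patch_sub (patch_Cc (hxi k)) xiE.
  rewrite patch_sub (patch_Cc (hw k)) in hk.
  (* [A * C] is a Lipschitz constant of [t |-> a x * G t]; the term with coefficient 0 only fits the
     estimate to the two-term lemma. *)
  apply: (@le_lt_trans _ _ ((A * C)%:E * N (w k \- (u \_ U)) + 0%:E * N (w k))%E).
    have m1 : measurable_fun setT (xi_ k \- (fun x => a x * G ((u \_ U) x))).
      by apply: measurable_funB => //; exact: measurable_Cc (hxi k).
    have m2 : measurable_fun setT (w k \- (u \_ U)) by apply: measurable_funB;
        [exact: mw|exact: mu_].
    apply: (le_LnormD mu (ltW p1)) => //; [by rewrite mulr_ge0// ltW|exact: mw|].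
    move=> x; rewrite /xi_ /= -mulrBr normrM mul0r addr0 -mulrA.
    by apply: ler_pM => //; exact: lG.
  rewrite mul0e adde0.
  apply: (@le_lt_trans _ _ ((A * C)%:E * (e / (A * C + 1))%:E)%E).
    by apply: lee_wpmul2l; [rewrite lee_fin mulr_ge0// ltW|exact: ltW].
  rewrite -EFinM lte_fin mulrCA -ltr_pdivlMl// mulVf ?gt_eqF//.
  by rewrite ltr_pdivrMr// mul1r; lra.
- move=> i; apply/Lp_cvgP => e e0.
  have [B B0 bB] := Cc_bounded_partial i ha.
  have cdwi := (Lp_cvgP _ _ _ _).1 (cdw i).
  have AC0 : 0 <= A * C by rewrite mulr_ge0// ltW.
  have AC2 : 0 <= 2 * (A * C) by rewrite mulr_ge0.
  (* Three errors will appear, each to be kept strictly below [e / 3]. The [+ 1] guards against a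
     zero coefficient and makes the bound strict, as in [third] below. *)
  have d0 : 0 < e / (3 * (A * C + 1)).
    by apply: divr_gt0 => //; apply: mulr_gt0 => //; lra.
  have d2 : 0 < e / (3 * (2 * (A * C) + 1)).
    by apply: divr_gt0 => //; apply: mulr_gt0 => //; lra.
  (* [G1 (w k) - G1 u] is small in L^p only, while [g_i] is unbounded: [g_i] is
     split as the bounded [partial i (w m)], with [m] fixed, and a remainder
     small in L^p. *)
  have [m _ /(_ m (leqnn m)) /= hm] := cdwi _ d2.
  have [D D0 bD] := Cc_bounded_partial i (hw m).
  (* The total coefficient of [|w k - u|]: [B * C] comes from the term with the derivative of [a],
     and [A * C * D] from the change of [G1] multiplied by the bounded part of [g_i]. The remainder
     of [g_i] meets [|G1 (w k) - G1 u| <= 2 * C], whence the coefficient [2 * (A * C)]. *)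
  pose c := B * C + A * C * D.
  have c0 : 0 <= c by rewrite addr_ge0// mulr_ge0// ltW.
  have d1 : 0 < e / (3 * (c + 1)) by apply: divr_gt0 => //; apply: mulr_gt0 => //; lra.
  have := (Lp_cvgP _ _ _ _).1 cw _ d1; have := cdwi _ d0.
  apply: filterS2 => k hdk hk.
  rewrite patch_sub (patch_partial_Cc _ (hxi k)) dxiE dxi_.
  rewrite patch_sub (patch_Cc (hw k)) in hk.
  rewrite patch_sub (patch_partial_Cc _ (hw k)) in hdk.
  rewrite patch_sub (patch_partial_Cc _ (hw m)) in hm.
  set gi := ((fun x => g x ord0 i) \_ U) in hdk hm *.
  apply: (@le_lt_trans _ _ (c%:E * N (w k \- (u \_ U)) + (A * C)%:E * N (partial i (w
      k) \- gi)
     + (2 * (A * C))%:E * N (partial i (w m) \- gi))%E).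
    have m1 : measurable_fun setT ((fun x => a x * (G1 (w k x) * partial i (w k) x) +
        G (w k x) * partial i a x)
        \- (fun x => partial i a x * G ((u \_ U) x) + a x * G1 ((u \_ U) x) * gi x)).
      apply: measurable_funB; last exact: mdxi.
      by rewrite -dxi_; exact: measurable_Cc_partial (hxi k).
    have m2 : measurable_fun setT (w k \- (u \_ U)) by apply: measurable_funB;
        [exact: mw|exact: mu_].
    have m3 l : measurable_fun setT (partial i (w l) \- gi).
      by apply: measurable_funB; [exact: mdw|exact: mg].
    apply: (le_LnormD3 mu (ltW p1)) => //; try exact: m3.
    move=> x /=.
    set U0 := (u \_ U) x; set W := w k x; set dW := partial i (w k) x.
    rewrite (_ : _ - _ = partial i a x * (G W - G U0) + a x * (G1 W * (dW - gi x))
        + a x * ((G1 W - G1 U0) * gi x)); last by ring.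
    apply: (le_trans (ler_normD _ _)); rewrite [leRHS](_ : _ =
      (B * (C * `|W - U0|) + A * (C * `|dW - gi x|)) +
      A * ((C * `|W - U0|) * D + 2 * C * `|partial i (w m) x - gi x|)); last by
          rewrite /c; ring.
    apply: lerD.
      apply: (le_trans (ler_normD _ _)); apply: lerD; rewrite normrM; apply: ler_pM => //.
      by rewrite normrM; apply: ler_pM.
    rewrite normrM; apply: ler_pM => //; rewrite normrM.
    have h1 : `|gi x| <= D + `|partial i (w m) x - gi x|.
      rewrite -[gi x](subKr (partial i (w m) x)) {1}distrC.
      by apply: (le_trans (ler_normB _ _)); rewrite addrC lerD// subKr.
    apply: (le_trans (ler_wpM2l (normr_ge0 _) h1)); rewrite mulrDr; apply: lerD.
      by apply: ler_wpM2r; [exact: ltW|exact: lG1].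
    apply: ler_wpM2r => //; apply: (le_trans (ler_normB _ _)).
    by have := bG1 W; have := bG1 U0; lra.
  apply: (@le_lt_trans _ _ (c%:E * (e / (3 * (c + 1)))%:E + (A * C)%:E * (e / (3 * (A
      * C + 1)))%:E
     + (2 * (A * C))%:E * (e / (3 * (2 * (A * C) + 1)))%:E)%E).
    by apply: leeD; [apply: leeD|]; apply: lee_wpmul2l; rewrite ?lee_fin//; exact: ltW.
  rewrite -!EFinM -!EFinD lte_fin.
  have third z : 0 <= z -> z * (e / (3 * (z + 1))) < e / 3.
    move=> z0; rewrite invfM !mulrA ltr_pdivrMr; last lra.
    nra.
  have := third _ c0; have := third _ AC0; have := third _ AC2; lra.
Qed.

End sobolev_product.

(** * Existence of test functions *)

Section bump.
Context (R : realType).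

(* The span of these functions, [x^-j exp(-1/x)] for [x > 0], is closed under
   differentiation. *)
Definition flat (j : nat) (x : R) : R := if 0 < x then x^-1 ^+ j * expR (- x^-1) else 0.

(** From [expR (y/m) >= 1 + y/m >= y/m], raised to the power [m]. *)
Lemma exprn_expRN_le (m : nat) (y : R) : 0 <= y -> y ^+ m * expR (- y) <= m%:R ^+ m.
Proof.
case: m => [|m] y0; first by rewrite !expr0 mul1r -expR0 ler_expR oppr_le0.
have m0 : (0 : R) < m.+1%:R by rewrite ltr0n.
rewrite expRN ler_pdivrMr ?expR_gt0//.
have -> : y = m.+1%:R * (y / m.+1%:R) by rewrite mulrCA divff ?mulr1// gt_eqF.
rewrite {2}mulrC expRM_natr exprMn ler_pM2l ?exprn_gt0//.
have z0 : 0 <= y / m.+1%:R by rewrite divr_ge0// ltW.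
apply: lerXn2r; rewrite ?nnegrE ?expR_ge0//.
by apply: (le_trans _ (expR_ge1Dx _)); rewrite lerDr.
Qed.

(** The previous bound at [1/x] with exponent [j + 2]: the two spare powers give a quadratic bound,
    enough for a zero derivative at the origin. *)
Lemma flat_le j x : `|flat j x| <= j.+2%:R ^+ j.+2 * x ^+ 2.
Proof.
rewrite /flat; case: ifPn => x0; last first.
  by rewrite normr0; apply: mulr_ge0; [exact: exprn_ge0|exact: sqr_ge0].
rewrite ger0_norm ?mulr_ge0 ?exprn_ge0 ?invr_ge0 ?expR_ge0 ?(ltW x0)//.
have := @exprn_expRN_le j.+2 x^-1 ltac:(by rewrite invr_ge0 ltW).
have -> : x^-1 ^+ j.+2 * expR (- x^-1) = (x^-1 ^+ j * expR (- x^-1)) / x ^+ 2.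
  by rewrite -addn2 exprD exprVn (exprVn x 2) mulrAC.
by rewrite ler_pdivrMr// exprn_gt0.
Qed.

Lemma is_derive_flat j x :
  is_derive x (1 : R) (flat j) (- j%:R * flat j.+1 x + flat j.+2 x).
Proof.
have [x0|x0|->] := ltgtP x 0.
- have -> : - j%:R * flat j.+1 x + flat j.+2 x = 0.
    by rewrite /flat ltNge (ltW x0)/= mulr0 addr0.
  have h0 := is_derive_cst (0 : R) x (1 : R).
  apply: near_eq_is_derive h0.
  have /filterS : nbhs x [set y | y < 0] by apply: open_nbhs_nbhs; split => //;
      exact: open_lt.
  by apply => y /= y0; rewrite /flat ltNge (ltW y0).
- have x_neq0 : x != 0 by rewrite gt_eqF.
  have dV : is_derive x (1 : R) (fun y => y^-1) (- x ^- 2).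
    have := is_deriveV x_neq0 (is_derive_id x (1 : R)).
    by move=> h; apply: is_derive_eq h _; rewrite [_%:A]mulr1.
  have dX := is_deriveX j dV.
  have dE : is_derive x (1 : R) (fun y => expR (- y^-1)) (expR (- x^-1) * (x ^- 2)).
    have dN := is_deriveN dV; rewrite opprK in dN.
    have := is_derive_comp_line dN (is_derive_expR _); exact.
  apply: is_derive_eq (near_eq_is_derive _ (is_deriveM dX dE)) _.
    have /filterS : nbhs x [set y | 0 < y] by apply: open_nbhs_nbhs; split => //;
        exact: open_gt.
    by apply => y /= y0; rewrite /flat y0 exprfctE.
  rewrite exprfctE /flat x0 /GRing.scale /= -!exprVn.
  case: j {dX} => [|j] /=; rewrite ?expr0 !(exprS _ _) /=; ring.
(* At the origin the difference quotient is estimated directly: by [flat_le] it is at most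
   [C * |h|]. *)
- have -> : - j%:R * flat j.+1 0 + flat j.+2 0 = 0 by rewrite /flat ltxx mulr0 addr0.
  have c : h^-1 *: ((flat j \o shift 0) (h *: (1 : R)) - flat j 0) @[h --> (0 : R)^']
      --> (0 : R).
    apply/cvgr0Pnorm_lt => e e0.
    pose C : R := j.+2%:R ^+ j.+2; have C0 : 0 < C by rewrite exprn_gt0.
    near=> h.
    have h0 : h != 0 by near: h; exact: nbhs_dnbhs_neq.
    have he : `|h| < e / C.
      by near: h; apply: dnbhs0_lt; rewrite divr_gt0.
    rewrite /flat ltxx subr0 /= addr0 -/(flat j (h *: 1)) [h *: 1]mulr1 normrM normfV.
    rewrite mulrC ltr_pdivrMr ?normr_gt0//.
    apply: (le_lt_trans (flat_le j h)); rewrite -/C -[h ^+ 2]real_normK ?num_real//.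
    by rewrite expr2 mulrA ltr_pM2r ?normr_gt0// mulrC -ltr_pdivlMr.
  apply: DeriveDef; first by apply: cvgP c.
  exact: cvg_lim.
Unshelve. all: by end_near.
Qed.

Lemma Cn_flat n k j (phi : 'rV[R]_n -> R) : Cn k phi -> Cn k (fun x => flat j (phi x)).
Proof.
move=> h.
apply: (@Cn_comp R n nat flat setT (fun j => [:: (- j%:R, j.+1); (1, j.+2)])) => //
    {}j x _.
by rewrite big_cons big_seq1 /= mul1r; exact: is_derive_flat.
Qed.

Lemma exists_bump n (U : set 'rV[R]_n) : open U -> U !=set0 ->
  exists phi, Cc_infty U phi /\ ~ ae_in U (fun x => phi x = 0).
Proof.
move=> oU [a Ua].
have /nbhs_ballP[e /= e0 eU] : nbhs a U by apply: open_nbhs_nbhs.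
pose r := e / 2; have r0 : 0 < r by rewrite divr_gt0.
(* The argument of [flat] is [r^2 - |x - a|^2] with the Euclidean norm. It is positive only in a
   Euclidean ball, hence in the sup-norm box of radius [r = e/2], whose closure lies in [U]. *)
pose phi (x : 'rV[R]_n) := flat 0 (r ^+ 2 + \sum_i (- 1) * ((x ord0 i - a ord0 i) *
    (x ord0 i - a ord0 i))).
have phi_pos x : phi x != 0 -> box a r x.
  rewrite /phi /flat; case: ifPn => [+ _|]; last by rewrite eqxx.
  move=> h i; rewrite -(ltr_pXn2r (n := 2))// ?nnegrE// ?(ltW r0)//.
  rewrite real_normK ?num_real//; rewrite (bigD1 i)//= in h.
  have : \sum_(j < n | j != i) -1 * ((x ord0 j - a ord0 j) * (x ord0 j - a ord0 j)) <= 0.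
    by apply: sumr_le0 => j _; rewrite mulN1r oppr_le0 -expr2 sqr_ge0.
  by rewrite expr2; lra.
have Cphi : Cc_infty U phi.
  apply: (Cc_intro (K := (fun x => x + a) @` [set x : 'rV[R]_n | `|x| <= r])).
  - move=> k; apply: Cn_flat; apply: CnD; first exact: Cn_cst.
    apply: Cn_sum => i; apply: CnM; first exact: Cn_cst.
    by apply: CnM; apply: CnD; try exact: Cn_coord; exact: Cn_cst.
  - apply: continuous_compact; last exact: compact_norm_le.
    by apply: continuous_subspaceT => x; apply: continuousD; [exact: cvg_id|exact:
        cst_continuous].
  - move=> _ [x /= xr <-]; apply: eU; rewrite -ball_normE /= opprD addrCA subrr addr0
      normrN.
    by apply: (le_lt_trans xr); rewrite /r ltr_pdivrMr// ltr_pMr// ltr1n.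
  - move=> x Kx; apply/eqP/negP => /negP/phi_pos bx; apply: Kx; exists (x - a); last
      by rewrite subrK.
    by apply: box0_norm => // i; rewrite !mxE subr0; exact: bx.
exists phi; split => // -[A [mA A0 sub]].
(* [V] is open and contains [a], so it has positive measure and cannot lie in a null set. *)
pose V := [set x | phi x != 0].
have oV : open V.
  rewrite (_ : V = phi @^-1` [set y | y != 0])//.
  by apply: open_comp => [x _|]; [exact: (Cc_continuous Cphi)|exact: open_neq].
have VU : V `<=` U.
  have [K [_ KU h _]] := Cc_support Cphi => x Vx; apply: KU; apply: contrapT => /h hx.
  by move: Vx; rewrite /V /= hx eqxx.
have : (0 < lebesgue_rV R n V)%E.
  apply: open_measure_gt0 => //; exists a; rewrite /V /phi /= /flat.
  rewrite big1 => [|i _]; last by rewrite subrr !mulr0.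
  by rewrite addr0 exprn_gt0// expr0 mul1r gt_eqF// expR_gt0.
apply/negP; rewrite -leNgt -A0; apply: le_measure; rewrite ?inE//.
  exact: open_measurable_rV.
move=> x Vx; apply: sub => /= h; have := h (VU _ Vx) => hx.
by move: Vx; rewrite /V /= hx eqxx.
Qed.

Lemma lambda1_lty n (p : R) (U : set 'rV[R]_n) : 1 < p -> open U -> U !=set0 ->
  (lambda1 p U < +oo)%E.
Proof.
move=> p1 oU U0; have [phi [Cphi phi0]] := exists_bump oU U0.
apply: (@le_lt_trans _ _ (rayleigh p U phi (fun x => \row_i partial i phi x))%:E);
    last exact: ltry.
apply: ereal_inf_lbound; exists phi, (fun x => \row_i partial i phi x); split => //.
exact: W01p_Cc.
Qed.

End bump.

(** * Picone's inequality *)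

Section euclidean_norm.
Context (R : realType) (n : nat).
Implicit Types x y : 'rV[R]_n.

Lemma dotp_ge0 x : 0 <= dotp x x.
Proof. by apply: sumr_ge0 => i _; rewrite -expr2 sqr_ge0. Qed.

Lemma enorm_ge0 x : 0 <= enorm x. Proof. exact: sqrtr_ge0. Qed.

Lemma enorm_sqr x : enorm x ^+ 2 = dotp x x.
Proof. by rewrite sqr_sqrtr// dotp_ge0. Qed.

Lemma dotpDr x y z : dotp x (y + z) = dotp x y + dotp x z.
Proof. by rewrite /dotp -big_split; apply: eq_bigr => i _; rewrite mxE mulrDr. Qed.

Lemma dotpZr a x y : dotp x (a *: y) = a * dotp x y.
Proof. by rewrite /dotp mulr_sumr; apply: eq_bigr => i _; rewrite mxE mulrCA. Qed.

Lemma dotpC x y : dotp x y = dotp y x.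
Proof. by apply: eq_bigr => i _; rewrite mulrC. Qed.

Lemma enorm_eq0 x : enorm x = 0 -> x = 0.
Proof.
move=> x0; have : dotp x x = 0 by rewrite -enorm_sqr x0 expr0n.
move=> /eqP; rewrite psumr_eq0 => [/allP h|i _]; last by rewrite -expr2 sqr_ge0.
apply/rowP => i; rewrite mxE; apply/eqP; rewrite -sqrf_eq0 expr2.
by apply: h; rewrite mem_index_enum.
Qed.

Lemma dotp_le x y : dotp x y <= enorm x * enorm y.
Proof.
have := enorm_ge0 x; rewrite le_eqVlt => /orP[/eqP/esym/enorm_eq0 ->|x0].
  by rewrite /dotp big1 => [|i _]; [rewrite mulr_ge0// enorm_ge0|rewrite mxE mul0r].
have := enorm_ge0 y; rewrite le_eqVlt => /orP[/eqP/esym/enorm_eq0 ->|y0].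
  by rewrite /dotp big1 => [|i _]; [rewrite mulr_ge0// enorm_ge0|rewrite mxE mulr0].
set a := enorm x in x0 *; set b := enorm y in y0 *.
(* Expanding this square gives [2ab (ab - dotp x y) >= 0], where [a] and [b] are the two norms. *)
have := dotp_ge0 (b *: x + (- a) *: y).
rewrite dotpDr !dotpZr !(dotpC (_ + _)) !dotpDr !dotpZr (dotpC y x) -!enorm_sqr -/a
    -/b => h.
have ab : 0 < 2 * (a * b) by rewrite !mulr_gt0.
rewrite -(ler_pM2l ab); nra.
Qed.

Lemma normr_dotp_le x y : `|dotp x y| <= enorm x * enorm y.
Proof.
rewrite ler_norml dotp_le andbT lerNl.
have -> : - dotp x y = dotp x ((-1) *: y) by rewrite dotpZr mulN1r.
apply: (le_trans (dotp_le _ _)).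
by rewrite {2}/enorm dotpZr dotpC dotpZr mulrA mulrNN !mul1r.
Qed.

Lemma enormD x y : enorm (x + y) <= enorm x + enorm y.
Proof.
rewrite -(ler_pXn2r (n := 2))// ?nnegrE ?addr_ge0 ?enorm_ge0//.
rewrite sqrrD !enorm_sqr dotpDr !(dotpC (_ + _)) !dotpDr (dotpC y x).
have := dotp_le x y; lra.
Qed.

(** Carries L^p information from the components of a gradient to its Euclidean norm. *)
Lemma enorm_le_sum x : enorm x <= \sum_i `|x ord0 i|.
Proof.
have S0 : 0 <= \sum_i `|x ord0 i| by apply: sumr_ge0.
rewrite -(ler_pXn2r (n := 2))// ?nnegrE ?enorm_ge0// enorm_sqr expr2 mulr_suml.
apply: ler_sum => i _; rewrite -expr2 -real_normK ?num_real// expr2.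
by rewrite ler_wpM2l// (bigD1 i)//= lerDl sumr_ge0.
Qed.

Lemma measurable_dotp d (T : measurableType d) (D : set T) (v w : T -> 'rV[R]_n) :
  (forall i, measurable_fun D (fun x : T => v x ord0 i : measurableTypeR R)) ->
  (forall i, measurable_fun D (fun x : T => w x ord0 i : measurableTypeR R)) ->
  measurable_fun D (fun x : T => dotp (v x) (w x) : measurableTypeR R).
Proof.
move=> mv mw; apply: (@measurable_sum _ _ R D _ _ (fun i (x : T) => v x ord0 i * w x
    ord0 i)) => i.
by apply: measurable_funM; [exact: mv|exact: mw].
Qed.

Lemma measurable_enorm d (T : measurableType d) (D : set T) (v : T -> 'rV[R]_n) :
  (forall i, measurable_fun D (fun x : T => v x ord0 i : measurableTypeR R)) ->
  measurable_fun D (fun x : T => enorm (v x) : measurableTypeR R).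
Proof.
move=> mv; rewrite [X in measurable_fun _ X](_ : _ = fun x : T => dotp (v x) (v x) `^
    2^-1).
  by apply: (measurableT_comp (measurable_powR _)); exact: measurable_dotp.
by apply/funext => x; rewrite powR12_sqrt// dotp_ge0.
Qed.

End euclidean_norm.

(** * Weighted Young inequality and the regularised negative power *)

Section scalar.
Context (R : realType) (p : R) (p1 : 1 < p).

Let p0 : 0 < p. Proof. exact: lt_trans ltr01 p1. Qed.
Let pm1 : 0 < p - 1. Proof. by rewrite subr_gt0. Qed.

(** Young's inequality for [A * t^(-(p-1)/p)] and [Y^(p-1) * t^((p-1)/p)], whose product no longer
    contains [t]. The weight puts the factor [t] on [Y^p], so that this term can be absorbed exactly
    in Picone's inequality. *)
Lemma young_powR (A Y t : R) : 0 <= A -> 0 <= Y -> 0 < t ->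
  p * (A * Y `^ (p - 1)) <= t `^ (1 - p) * A `^ p + (p - 1) * t * Y `^ p.
Proof.
move=> A0 Y0 t0.
have t_neq0 : t != 0 by rewrite gt_eqF.
have p_neq0 : p != 0 by rewrite gt_eqF.
have pm_neq0 : p - 1 != 0 by rewrite gt_eqF.
pose q := p / (p - 1).
have q0 : 0 < q by rewrite divr_gt0.
have pq : p^-1 + q^-1 = 1 by rewrite /q; field; rewrite p_neq0 pm_neq0.
have := @conjugate_powR R (A * t `^ (- ((p - 1) / p))) (Y `^ (p - 1) * t `^ ((p - 1)
    / p)) p q
  ltac:(by rewrite mulr_ge0 ?powR_ge0) ltac:(by rewrite mulr_ge0 ?powR_ge0) p0 q0 pq.
have -> : A * t `^ (- ((p - 1) / p)) * (Y `^ (p - 1) * t `^ ((p - 1) / p)) = A * Y `^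
    (p - 1).
  rewrite mulrACA -powRD; last by rewrite t_neq0 implybT.
  by rewrite addNr powRr0 mulr1.
rewrite !powRM ?powR_ge0// -!powRrM.
have -> : - ((p - 1) / p) * p = 1 - p by field.
have -> : (p - 1) * q = p by rewrite /q; field.
have -> : (p - 1) / p * q = 1 by rewrite /q; field; rewrite p_neq0 pm_neq0.
rewrite (powRr1 (ltW t0)) => h.
apply: (le_trans (ler_wpM2l (ltW p0) h)).
rewrite le_eqVlt; apply/orP; left; apply/eqP; rewrite /q; field.
by rewrite p_neq0 pm_neq0.
Qed.

Lemma ler_powR_npos (q s x : R) : q <= 0 -> 0 < s -> s <= x -> x `^ q <= s `^ q.
Proof.
move=> q0 s0 sx; rewrite -(opprK q) !(powRN _ (- q)).
have x0 := lt_le_trans s0 sx.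
rewrite lef_pV2 ?posrE ?powR_gt0//.
by apply: ge0_ler_powR; rewrite ?nnegrE ?oppr_ge0// ltW.
Qed.

Context (s : R) (s0 : 0 < s).

(* A smooth substitute for [|t|^(1-p)]. *)
Definition reg (t : R) : R := (t * t + s) `^ ((1 - p) / 2).
Definition reg1 (t : R) : R := (1 - p) * t * (t * t + s) `^ ((1 - p) / 2 - 1).

Let X0 t : 0 < t * t + s. Proof. by rewrite ltr_wpDl// -expr2 sqr_ge0. Qed.
Let Xs t : s <= t * t + s. Proof. by rewrite lerDr -expr2 sqr_ge0. Qed.

Let dX (t : R) : is_derive t (1 : R) (fun t => t * t + s) (2 * t).
Proof.
have h := is_deriveD (is_deriveM (is_derive_id t (1 : R)) (is_derive_id t (1 : R)))
    (is_derive_cst s t (1 : R)).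
by apply: is_derive_eq h _; rewrite /GRing.scale /=; ring.
Qed.

Let dXq (q t : R) : is_derive t (1 : R) (fun t => (t * t + s) `^ q) (q * (t * t + s)
    `^ (q - 1) * (2 * t)).
Proof. exact: (is_derive_comp_line (dX t) (is_derive1_powR q (X0 t))). Qed.

Lemma is_derive_reg t : is_derive t (1 : R) reg (reg1 t).
Proof. by apply: is_derive_eq (dXq _ t) _; rewrite /reg1; field. Qed.

Let reg2 (t : R) : R := (1 - p) * (t * t + s) `^ ((1 - p) / 2 - 1) +
  (1 - p) * t * (((1 - p) / 2 - 1) * (t * t + s) `^ ((1 - p) / 2 - 2) * (2 * t)).

Let is_derive_reg1 t : is_derive t (1 : R) reg1 (reg2 t).
Proof.
have h := is_deriveM (is_deriveM (is_derive_cst (1 - p) t (1 : R)) (is_derive_id t (1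
    : R)))
  (dXq ((1 - p) / 2 - 1) t).
apply: is_derive_eq h _; rewrite /reg2 /GRing.scale /=.
have -> : (1 - p) / 2 - 1 - 1 = (1 - p) / 2 - 2 by ring.
have -> : (cst (1 - p) * id) t = (1 - p) * t by [].
ring.
Qed.

Lemma continuous_reg1 : continuous reg1.
Proof. by move=> t; apply/differentiable_continuous/derivable1_diffP; have [] :=
    is_derive_reg1 t. Qed.

Lemma Cn_reg n k (phi : 'rV[R]_n -> R) : Cn k phi -> Cn k (fun x => reg (phi x)).
Proof.
move=> h; apply: Cn_powR => [x|]; first exact: X0.
by apply: CnD; [exact: CnM|exact: Cn_cst].
Qed.

(** These are the bounds that [W01p_mul_comp] requires of [G]. They hold because
    [t * t + s >= s > 0] and the exponents are nonpositive; factors of [t] are absorbed by raising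
    the exponent. *)
Lemma reg_bounds : exists C, [/\ forall t, `|reg t| <= C, forall t, `|reg1 t| <= C &
  forall t t', `|reg1 t - reg1 t'| <= C * `|t - t'|].
Proof.
pose r := (1 - p) / 2.
have r0 : r <= 0 by rewrite /r; move: pm1; lra.
have r1 : r - 1 <= 0 by lra.
have s1 := powR_ge0 s r; have s2 := powR_ge0 s (r - 1).
have b1 t := @ler_powR_npos r s _ r0 s0 (Xs t).
have b2 t := @ler_powR_npos (r - 1) s _ r1 s0 (Xs t).
have Xn t : t * t + s != 0 by rewrite gt_eqF.
have e1 t : (t * t + s) `^ (r - 1) * (t * t + s) = (t * t + s) `^ r.
  by rewrite powRB ?Xn ?implybT// (powRr1 (ltW (X0 t))) divfK.
have e2 t : (t * t + s) `^ (r - 2) * (t * t + s) = (t * t + s) `^ (r - 1).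
  rewrite (_ : r - 2 = r - 1 - 1); last by ring.
  by rewrite powRB ?Xn ?implybT// (powRr1 (ltW (X0 t))) divfK.
pose q := p - 1; have q0 : 0 < q by [].
pose C1 := q * (s `^ r + s `^ (r - 1)).
pose C2 := q * s `^ (r - 1) + 2 * q * (1 - r) * s `^ (r - 1).
have h1 t : `|reg1 t| <= C1.
  rewrite /reg1 -/r !normrM (ger0_norm (powR_ge0 _ _)) distrC (ger0_norm (ltW pm1)).
  rewrite -mulrA; apply: ler_wpM2l; first exact: ltW.
  have := b1 t; have := b2 t; rewrite -(e1 t); have := powR_ge0 (t * t + s) (r - 1).
  set Z := _ `^ (r - 1) => Z0 bz bx.
  (* From [(|t| - 1)^2 >= 0]. Multiplied by [Z], it bounds [|t| * Z] by the sum of two nonpositive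
     powers of [t * t + s]. *)
  have : `|t| <= 1 + (t * t + s).
    have := sqr_ge0 (`|t| - 1); rewrite sqrrB real_normK ?num_real// => h.
    have := normr_ge0 t; have := s0; rewrite -expr2; lra.
  move=> /(ler_wpM2r Z0); nra.
have h2 t : `|reg2 t| <= C2.
  rewrite /reg2 -/r; apply: (le_trans (ler_normD _ _)); apply: lerD.
    by rewrite normrM distrC (ger0_norm (ltW pm1)) ger0_norm ?powR_ge0// ler_wpM2l// ltW.
  rewrite [X in `|X| <= _](_ : _ = 2 * q * (1 - r) * (t * t * (t * t + s) `^ (r -
      2))); last first.
    by rewrite /q; ring.
  have c0 : 0 <= 2 * q * (1 - r) by rewrite !mulr_ge0// ?ltW//; lra.
  rewrite normrM (ger0_norm c0); apply: ler_wpM2l => //.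
  have tt : 0 <= t * t by rewrite -expr2 sqr_ge0.
  rewrite (ger0_norm (mulr_ge0 tt (powR_ge0 _ _))).
  apply: le_trans (b2 t); rewrite -(e2 t) mulrC ler_wpM2l ?powR_ge0//.
  by rewrite lerDl ltW.
exists (s `^ r + C1 + C2).
have C10 : 0 <= C1 by exact: le_trans (h1 0).
have C20 : 0 <= C2 by exact: le_trans (h2 0).
split => [t|t|t t'].
- by rewrite /reg ger0_norm ?powR_ge0//; have := b1 t; rewrite -/r; lra.
- by have := h1 t; lra.
- apply: (le_trans (bounded_derive_lipschitz is_derive_reg1 h2 t t')).
  by apply: ler_wpM2r => //; lra.
Qed.

End scalar.

(** * Pointwise estimates and the double limit *)

Section picone.
Context (R : realType) (p : R) (p1 : 1 < p).

Let p0 : 0 < p. Proof. exact: lt_trans ltr01 p1. Qed.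
Let pm1 : 0 < p - 1. Proof. by rewrite subr_gt0. Qed.

Lemma powR_half (x r : R) : 0 <= x -> x `^ (r / 2) = Num.sqrt x `^ r.
Proof. by move=> x0; rewrite -powR12_sqrt// -powRrM mulrC. Qed.

Lemma mulr_powRD (x r r' : R) : 0 < x -> x `^ r * x `^ r' = x `^ (r + r').
Proof. by move=> x0; rewrite powRD//; apply/implyP => _; rewrite gt_eqF. Qed.

Lemma mulr_powR1 (x r : R) : 0 < x -> x `^ r * x = x `^ (r + 1).
Proof. by move=> x0; rewrite -{2}(powRr1 (ltW x0)) mulr_powRD. Qed.

Lemma reg_sqrt (s t : R) : 0 < s -> reg p s t = Num.sqrt (t * t + s) `^ (1 - p).
Proof. by move=> s0; rewrite /reg powR_half// addr_ge0 ?(ltW s0) -?expr2 ?sqr_ge0. Qed.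

Lemma reg1_sqrt (s t : R) : 0 < s ->
  reg1 p s t = (1 - p) * t * Num.sqrt (t * t + s) `^ (- 1 - p).
Proof.
move=> s0; rewrite /reg1 -powR_half; last by rewrite addr_ge0 ?(ltW s0) -?expr2 ?sqr_ge0.
by congr (_ * _ * _ `^ _); field.
Qed.

(* Picone's inequality for [t = u x] and the test function
   [((phi^2 + e)^(p/2) - e^(p/2)) * reg (u)].  The factor [th < 1] measures how
   close [|t|] is to [sqrt (t^2 + s)], and is the price of the regularisation. *)
Lemma picone_pointwise n (g dphi : 'rV[R]_n) (ph e s th t : R) :
  0 < e -> 0 < s -> 0 < th -> th <= 1 -> th * Num.sqrt (t * t + s) <= - t ->
  - (enorm g `^ (p - 2) * dotp g (\row_i
       (p * (ph * ph + e) `^ ((p - 2) / 2) * ph * dphi ord0 i * reg p s t +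
        ((ph * ph + e) `^ (p / 2) - e `^ (p / 2)) * reg1 p s t * g ord0 i)))
  <= th `^ (1 - p) * enorm dphi `^ p +
     (p - 1) * e `^ (p / 2) * Num.sqrt s `^ (- p) * enorm g `^ p.
Proof.
move=> e0 s0 th0 th1 tM.
have P0 : 0 < ph * ph + e by rewrite ltr_wpDl// -expr2 sqr_ge0.
have X0 : 0 < t * t + s by rewrite ltr_wpDl// -expr2 sqr_ge0.
rewrite (reg_sqrt _ s0) (reg1_sqrt _ s0) (powR_half _ (ltW P0)) (powR_half p (ltW
    P0)) (powR_half p (ltW e0)).
(* In these variables the estimate resembles the classical one: [psi], [M] and [eps] are positive,
   [psi] dominates [|ph|], and [psi >= eps] makes [a] nonnegative. *)
set psi := Num.sqrt (ph * ph + e); set eps := Num.sqrt e; set M := Num.sqrt (t * t +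
    s) in tM *.
have psi0 : 0 < psi by rewrite sqrtr_gt0.
have eps0 : 0 < eps by rewrite sqrtr_gt0.
have M0 : 0 < M by rewrite sqrtr_gt0.
have eps_psi : eps <= psi by rewrite ler_sqrt ?(ltW P0)// lerDr -expr2 sqr_ge0.
have ph_psi : `|ph| <= psi by rewrite -sqrtr_sqr ler_sqrt ?(ltW P0)// expr2 lerDl ltW.
have sM : Num.sqrt s <= M by rewrite ler_sqrt ?(ltW X0)// lerDr -expr2 sqr_ge0.
have := sqrtr_gt0 s; rewrite s0; set del := Num.sqrt s in sM * => del0.
clearbody psi eps M del.
set a := psi `^ p - eps `^ p.
have a0 : 0 <= a by rewrite subr_ge0; apply: ge0_ler_powR => //; rewrite ?nnegrE ltW.
rewrite [X in dotp g X](_ : _ = (p * psi `^ (p - 2) * ph * M `^ (1 - p)) *: dphi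
   + (a * ((1 - p) * t * M `^ (-1 - p))) *: g); last first.
  by apply/rowP => i; rewrite !mxE; ring.
rewrite dotpDr !dotpZr -enorm_sqr.
set b := enorm g; set d := enorm dphi; set D := dotp g dphi.
have D_bd : `|D| <= b * d by exact: normr_dotp_le.
have d_ge0 : 0 <= d by exact: enorm_ge0.
have : 0 <= b by exact: enorm_ge0.
clearbody b d D => b_ge0.
have RHS0 : 0 <= th `^ (1 - p) * d `^ p + (p - 1) * eps `^ p * del `^ (- p) * b `^ p.
  by rewrite addr_ge0// !mulr_ge0// ?powR_ge0 ?(ltW pm1).
(* A vanishing [g] is treated apart, since powers of [b] can be merged only for [b > 0]. The left
   side is then 0. *)
move: b_ge0; rewrite le_eqVlt => /orP[/eqP b0|b0].
  have D0 : D = 0 by apply/eqP; rewrite -normr_le0 (le_trans D_bd)// -b0 mul0r.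
  have bb : b ^+ 2 = 0 by rewrite -b0 expr0n.
  by rewrite D0 bb !mulr0 addr0 mulr0 oppr0.
have bp : b `^ (p - 2) * b ^+ 2 = b `^ p.
  by rewrite -(powR_mulrn _ (ltW b0)) mulr_powRD// subrK.
have bpm : b `^ (p - 2) * b = b `^ (p - 1).
  rewrite mulr_powR1//; congr (_ `^ _); ring.
have psipm : psi `^ (p - 2) * psi = psi `^ (p - 1).
  rewrite mulr_powR1//; congr (_ `^ _); ring.
have Mm : M `^ (-1 - p) * M = M `^ (- p).
  rewrite mulr_powR1//; congr (_ `^ _); ring.
(* The quantity [phi |grad u| / |u|] of Picone's inequality, to be paired with [d = |grad phi|] in
   Young's inequality with weight [th]. *)
pose Y := psi * b / M.
have Y0 : 0 <= Y by rewrite divr_ge0 ?mulr_ge0// ltW.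
have Yr r : Y `^ r = psi `^ r * b `^ r * M `^ (- r).
  have Mi : 0 <= M^-1 by rewrite invr_ge0 ltW.
  have pb : 0 <= psi * b by rewrite mulr_ge0// ltW.
  rewrite /Y (powRM r pb Mi) (powRM r (ltW psi0) (ltW b0)).
  by congr (_ * _); rewrite -[M^-1](powR_inv1 (ltW M0)) -powRrM mulN1r.
have yg := young_powR p1 d_ge0 Y0 th0.
rewrite !Yr opprB in yg.
set Z := b `^ p * M `^ (- p).
have Z0 : 0 <= Z by rewrite mulr_ge0 ?powR_ge0.
have T1 : - (b `^ (p - 2) * (p * psi `^ (p - 2) * ph * M `^ (1 - p) * D)) <=
    p * (d * (psi `^ (p - 1) * b `^ (p - 1) * M `^ (1 - p))).
  rewrite -psipm -bpm; apply: (le_trans (ler_norm _)); rewrite normrN.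
  rewrite [X in `|X|](_ : _ = (p * b `^ (p - 2) * psi `^ (p - 2) * M `^ (1 - p)) *
      (ph * D)); last by ring.
  have c0 : 0 <= p * b `^ (p - 2) * psi `^ (p - 2) * M `^ (1 - p).
    by rewrite !mulr_ge0 ?powR_ge0// ltW.
  rewrite [leRHS](_ : _ = (p * b `^ (p - 2) * psi `^ (p - 2) * M `^ (1 - p)) * (psi *
      (b * d))); last by ring.
  rewrite normrM (ger0_norm c0); apply: ler_wpM2l => //.
  by rewrite normrM; apply: ler_pM.
(* The favourable term: the derivative of [reg] has the sign of [-t], and [-t >= th * M] bounds it
   from below. Its part in [psi^p] cancels the [Y^p] term of Young's inequality. *)
have T2 : - (b `^ (p - 2) * (a * ((1 - p) * t * M `^ (-1 - p)) * b ^+ 2)) <= - (a *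
    (p - 1) * th * Z).
  rewrite lerN2 [leRHS](_ : _ = a * (p - 1) * (- t) * M `^ (-1 - p) * (b `^ (p - 2) *
      b ^+ 2)); last by ring.
  rewrite bp [leLHS](_ : _ = a * (p - 1) * (th * M) * M `^ (-1 - p) * b `^ p); last first.
    by rewrite /Z -Mm; ring.
  do 2 (apply: ler_wpM2r; first exact: powR_ge0).
  by apply: ler_wpM2l => //; rewrite mulr_ge0// ltW.
have Zs : Z <= del `^ (- p) * b `^ p.
  rewrite /Z [leLHS]mulrC; apply: ler_wpM2r; first exact: powR_ge0.
  by apply: ler_powR_npos => //; rewrite ?oppr_le0 ?(ltW p0).
rewrite mulrDr opprD; apply: (le_trans (lerD T1 T2)).
have eq1 : psi `^ p * b `^ p * M `^ (- p) = psi `^ p * Z by rewrite mulrA.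
rewrite eq1 in yg.
have c2 : 0 <= (p - 1) * eps `^ p by rewrite mulr_ge0 ?powR_ge0// ltW.
have h1 := ler_wpM2l c2 Zs.
have h2 : (p - 1) * th * eps `^ p * Z <= (p - 1) * eps `^ p * Z.
  apply: ler_wpM2r => //; rewrite mulrAC ler_piMr//.
apply: (le_trans (lerD yg (lexx _))).
(* After the cancellation only the [eps^p] part of [a] remains, and [Zs] bounds it uniformly in
   [t]. *)
rewrite [leLHS](_ : _ = th `^ (1 - p) * d `^ p + (p - 1) * th * eps `^ p * Z); last
    by rewrite /a; ring.
rewrite lerD2l -[leRHS]mulrA; exact: le_trans h2 h1.
Qed.

(** For negative [t], [|t|^(p-2) * t] equals [-(-t)^(p-1)], and [-t >= th * M] makes its product
    with [M^(1-p)] at most [-th^(p-1)]. The remaining factor is at least [|ph|^p - e^(p/2)]. *)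
Lemma source_pointwise (ph e s th t lam : R) :
  0 <= lam -> 0 < e -> 0 < s -> 0 < th -> th * Num.sqrt (t * t + s) <= - t ->
  lam * th `^ (p - 1) * (`|ph| `^ p - e `^ (p / 2)) <=
  - (lam * (`|t| `^ (p - 2) * t * (((ph * ph + e) `^ (p / 2) - e `^ (p / 2)) * reg p
      s t))).
Proof.
move=> lam0 e0 s0 th0 tM.
have P0 : 0 < ph * ph + e by rewrite ltr_wpDl// -expr2 sqr_ge0.
have X0 : 0 < t * t + s by rewrite ltr_wpDl// -expr2 sqr_ge0.
rewrite (reg_sqrt _ s0) (powR_half p (ltW P0)) (powR_half p (ltW e0)).
set psi := Num.sqrt (ph * ph + e); set eps := Num.sqrt e; set M := Num.sqrt (t * t +
    s) in tM *.
have psi0 : 0 < psi by rewrite sqrtr_gt0.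
have eps0 : 0 < eps by rewrite sqrtr_gt0.
have M0 : 0 < M by rewrite sqrtr_gt0.
have eps_psi : eps <= psi by rewrite ler_sqrt ?(ltW P0)// lerDr -expr2 sqr_ge0.
have ph_psi : `|ph| <= psi by rewrite -sqrtr_sqr ler_sqrt ?(ltW P0)// expr2 lerDl ltW.
set a := psi `^ p - eps `^ p.
have a0 : 0 <= a by rewrite subr_ge0; apply: ge0_ler_powR => //; rewrite ?nnegrE ltW.
have aph : `|ph| `^ p - eps `^ p <= a.
  by rewrite lerD2r; apply: ge0_ler_powR; rewrite ?nnegrE ?(ltW p0) ?(ltW psi0).
have thM0 : 0 < th * M by rewrite mulr_gt0.
have t0 : t < 0 by rewrite -oppr_gt0; exact: lt_le_trans tM.
have tE : `|t| `^ (p - 2) * t = - (- t) `^ (p - 1).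
  rewrite ltr0_norm// -{2}(opprK t) mulrN; congr (- _).
  have nt0 : 0 < - t by rewrite oppr_gt0.
  rewrite mulr_powR1//; congr (_ `^ _); ring.
rewrite tE !mulNr mulrN opprK -!mulrA; apply: ler_wpM2l => //.
have h : th `^ (p - 1) * M `^ (p - 1) <= (- t) `^ (p - 1).
  rewrite -powRM ?(ltW th0) ?(ltW M0)//; apply: ge0_ler_powR; rewrite ?nnegrE ?(ltW
      pm1) ?(ltW thM0)//.
  by rewrite oppr_ge0 ltW.
have MM : M `^ (p - 1) * M `^ (1 - p) = 1.
  by rewrite mulr_powRD// addrC addrA subrK subrr powRr0.
apply: (@le_trans _ _ (th `^ (p - 1) * a)); first by rewrite ler_wpM2l ?powR_ge0.
rewrite [leLHS](_ : _ = th `^ (p - 1) * M `^ (p - 1) * (a * M `^ (1 - p))); last first.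
  transitivity (th `^ (p - 1) * a * (M `^ (p - 1) * M `^ (1 - p))); first by rewrite
      MM mulr1.
  ring.
by apply: ler_wpM2r => //; rewrite mulr_ge0 ?powR_ge0.
Qed.

(* First [e] tends to 0, then [th] tends to 1. *)
Lemma homogeneous_limit (I J lam k : R) (C : R -> R) : 0 <= J ->
  (forall th e, 0 < th -> th < 1 -> 0 < e ->
    lam * th `^ (p - 1) * (I - e `^ (p / 2) * k) <=
    th `^ (1 - p) * J + e `^ (p / 2) * C th) ->
  lam * I <= J.
Proof.
move=> J0 h.
(* [C th] is not assumed bounded as [th] tends to 1, so [e] is eliminated at fixed [th]. *)
have h1 th : 0 < th -> th < 1 -> lam * th `^ (p - 1) * I <= th `^ (1 - p) * J.
  move=> th0 th1; apply/ler_addgt0Pr => z z0.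
  pose L := lam * th `^ (p - 1) * k + C th.
  have L0 : 0 < `|L| + 1 by rewrite ltr_wpDl.
  (* Chosen so that [e^(p/2) * L <= z], where [L] collects both error terms. *)
  pose e := (z / (`|L| + 1)) `^ (2 / p).
  have e0 : 0 < e by apply: powR_gt0; exact: divr_gt0.
  have := h th e th0 th1 e0.
  have -> : e `^ (p / 2) = z / (`|L| + 1).
    rewrite -powRrM (_ : 2 / p * (p / 2) = 1); last by field; rewrite gt_eqF.
    by rewrite powRr1// ltW// divr_gt0.
  have : z / (`|L| + 1) * L <= z.
    rewrite mulrAC ler_pdivrMr// ler_wpM2l ?(ltW z0)//.
    by have := ler_norm L; lra.
  rewrite /L; set y := z / _; nra.
have h2 y : 0 < y -> y < 1 -> lam * I * y <= J.
  (* With [th^(2(p-1)) = y], multiplying [h1] by [th^(p-1)] removes the power on the right and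
     leaves [y] on the left. *)
  move=> y0 y1; pose th := y `^ (2 * (p - 1))^-1.
  have q0 : 0 < (2 * (p - 1))^-1 by rewrite invr_gt0 mulr_gt0.
  have th0 : 0 < th by rewrite powR_gt0.
  have th1 : th < 1.
    have := @gt0_ltr_powR R _ q0 y 1; rewrite !nnegrE (ltW y0) ler01 powR1.
    by move=> /(_ isT isT y1).
  have c0 := powR_gt0 (p - 1) th0.
  have := h1 th th0 th1; rewrite -(ler_pM2l c0).
  rewrite [leRHS]mulrA mulr_powRD// [p - 1 + _]addrC addrA subrK subrr powRr0 mul1r.
  apply: le_trans; rewrite [leRHS](_ : _ = lam * I * (th `^ (p - 1) * th `^ (p -
      1))); last by ring.
  rewrite mulr_powRD// -powRrM.
  rewrite (_ : _ * (_ + _) = 1); last by field; rewrite gt_eqF.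
  by rewrite powRr1// ltW.
rewrite leNgt; apply/negP => JX.
have X0 : 0 < lam * I by exact: le_lt_trans JX.
(* If [J < lam * I], this [y] is below 1 and [lam * I * y] is the midpoint of [J] and [lam * I],
   which exceeds [J]. *)
have := h2 ((J + lam * I) / (2 * (lam * I))).
have y0 : 0 < (J + lam * I) / (2 * (lam * I)).
  by apply: divr_gt0; [exact: ltr_wpDl|exact: mulr_gt0].
have y1 : (J + lam * I) / (2 * (lam * I)) < 1.
  by rewrite ltr_pdivrMr ?mul1r; [lra|exact: mulr_gt0].
move=> /(_ y0 y1).
have -> : lam * I * ((J + lam * I) / (2 * (lam * I))) = (J + lam * I) / 2.
  have /andP[l0 i0] : (lam != 0) && (I != 0) by rewrite -negb_or -mulf_eq0 gt_eqF.
  by field; rewrite ?l0 ?i0.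
lra.
Qed.

End picone.

(** * Integrability of the terms of the weak equation *)

Section Lp_integrals.
Context (R : realType) (n : nat) (p : R) (p1 : 1 < p).
Local Notation mu := (lebesgue_rV R n).
Local Notation N f := ('N[mu]_p%:E[EFin \o f%R])%E.
Implicit Types (U : set 'rV[R]_n) (u : 'rV[R]_n -> R) (g v : 'rV[R]_n -> 'rV[R]_n).

Let p0 : 0 < p. Proof. exact: lt_trans ltr01 p1. Qed.

Lemma Rintegral_support U (h : 'rV[R]_n -> R) : (forall x, ~ U x -> h x = 0) ->
  \int[mu]_(x in U) h x = \int[mu]_x h x.
Proof.
move=> h0; rewrite Rintegral_mkcond; apply: eq_Rintegral => x _; rewrite patchE.
by case: ifPn => //; rewrite notin_setE => /h0.
Qed.

Lemma Lp_measurable_fun U u : measurable U -> Lp p U u -> measurable_fun U u.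
Proof. by move=> mU /Lp_measurable h; apply/(measurable_restrictT _ mU). Qed.

Lemma Lp_integrable_powR U u : measurable U -> Lp p U u ->
  mu.-integrable U (fun x => (`|u x| `^ p)%:E).
Proof.
move=> mU /(Lfun_integrable (ltW p1)) h; apply/(integrable_mkcond _ mU).
apply: eq_integrable h => // x _; rewrite !patchE; case: ifPn => //.
by rewrite normr0 powR0// gt_eqF.
Qed.

Lemma Lnorm_le_sum (I : Type) (r : seq I) (f h : 'rV[R]_n -> R) (k : I -> 'rV[R]_n -> R) :
  measurable_fun setT f -> measurable_fun setT h ->
  (forall i, measurable_fun setT (k i)) ->
  (forall x, `|f x| <= `|h x| + \sum_(i <- r) `|k i x|) ->
  (N f <= N h + \sum_(i <- r) N (k i))%E.
Proof.
move=> + mh mk; elim: r f => [|i r IH] f mf fh.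
  rewrite big_nil adde0; apply: (le_Lnorm mu (ltW p1)) => // x.
  by have := fh x; rewrite big_nil addr0.
pose f' x := `|h x| + \sum_(i <- r) `|k i x|.
have mf' : measurable_fun setT f'.
  apply: measurable_funD; first exact: measurableT_comp.
  by apply: measurable_sum => j; exact: measurableT_comp.
have f'0 x : 0 <= f' x by rewrite addr_ge0// sumr_ge0.
have h1 : (N f <= 1%:E * N f' + 1%:E * N (k i))%E.
  apply: (le_LnormD mu (ltW p1)) => // x; rewrite !mul1r (ger0_norm (f'0 x)).
  by have := fh x; rewrite big_cons /f'; lra.
rewrite big_cons addeCA addeC; apply: (le_trans h1); rewrite !mul1e.
by apply: leeD => //; apply: IH => // x; rewrite ger0_norm.
Qed.

Lemma Lp_enorm U v : measurable U -> (forall i, Lp p U (fun x => v x ord0 i)) ->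
  Lp p U (fun x => enorm (v x)).
Proof.
move=> mU Lv; have mv i := Lp_measurable_fun mU (Lv i).
have mE : measurable_fun setT ((fun x => enorm (v x)) \_ U).
  by apply/(measurable_restrictT _ mU); exact: measurable_enorm.
apply/in_LfunP; split => //.
have h : (N ((fun x => enorm (v x)) \_ U) <= N (fun=> 0%R) + \sum_(i < n) N ((fun x
    => v x ord0 i) \_ U))%E.
  apply: Lnorm_le_sum => //; first by move=> i; exact: Lp_measurable (Lv i).
  move=> x; rewrite normr0 add0r !patchE; case: ifPn => xU.
    rewrite (ger0_norm (enorm_ge0 _)); apply: (le_trans (enorm_le_sum _)).
    by apply: ler_sum => i _; rewrite patchE xU.
  by rewrite normr0 sumr_ge0.
have p_neq0 : (p%:E != 0)%E by rewrite eqe gt_eqF.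
apply: (le_lt_trans h); rewrite [X in Lnorm _ _ X](_ : _ = cst 0%E)// Lnorm0// add0e.
apply: lte_sum_pinfty => i _.
exact: ((in_LfunP mu p _).1 (Lv i)).2.
Qed.

(** The left side is at most the [p]-th power of the larger of [b] and [e]. This crude form of
    Young's inequality suffices for domination. *)
Lemma ler_powRM_add (b e : R) : 0 <= b -> 0 <= e -> b `^ (p - 2) * (b * e) <= b `^ p
    + e `^ p.
Proof.
move=> b0 e0; have pm1 : 0 < p - 1 by rewrite subr_gt0.
have := b0; rewrite le_eqVlt => /orP[/eqP <-|b_gt0].
  by rewrite mul0r mulr0 addr_ge0 ?powR_ge0.
rewrite mulrA mulr_powR1// (_ : p - 2 + 1 = p - 1); last by ring.
have [eb|/ltW be] := leP e b.
  rewrite -[leLHS]addr0; apply: lerD; last exact: powR_ge0.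
  rewrite -(mulr_powRB1 b0 p0) [leRHS]mulrC.
  by apply: ler_wpM2l => //; exact: powR_ge0.
rewrite -[leLHS]add0r; apply: lerD; first exact: powR_ge0.
rewrite -(mulr_powRB1 e0 p0) [leRHS]mulrC; apply: ler_wpM2r => //.
by apply: ge0_ler_powR; rewrite ?nnegrE ?(ltW pm1).
Qed.

Lemma integrable_flux U g v : measurable U ->
  (forall i, Lp p U (fun x => g x ord0 i)) -> (forall i, Lp p U (fun x => v x ord0 i)) ->
  mu.-integrable U (EFin \o (fun x => enorm (g x) `^ (p - 2) * dotp (g x) (v x))).
Proof.
move=> mU Lg Lv.
have mg i := Lp_measurable_fun mU (Lg i); have mv i := Lp_measurable_fun mU (Lv i).
have ig := Lp_integrable_powR mU (Lp_enorm mU Lg).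
have iv := Lp_integrable_powR mU (Lp_enorm mU Lv).
apply: le_integrable (integrableD mU ig iv) => //.
  apply/measurable_EFinP; apply: measurable_funM; last exact: measurable_dotp.
  by apply: (measurableT_comp (measurable_powR _)); exact: measurable_enorm.
move=> x _; rewrite /= lee_fin (ger0_norm (enorm_ge0 (g x))) (ger0_norm (enorm_ge0 (v
    x))).
rewrite [leRHS]ger0_norm ?addr_ge0 ?powR_ge0// normrM (ger0_norm (powR_ge0 _ _)).
apply: le_trans (ler_powRM_add (enorm_ge0 _) (enorm_ge0 _)).
by apply: ler_wpM2l; [exact: powR_ge0|exact: normr_dotp_le].
Qed.

Lemma integrable_source U u (v : 'rV[R]_n -> R) : measurable U -> Lp p U u -> Lp p U v ->
  mu.-integrable U (EFin \o (fun x => `|u x| `^ (p - 2) * u x * v x)).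
Proof.
move=> mU Lu Lv.
have mu' := Lp_measurable_fun mU Lu; have mv := Lp_measurable_fun mU Lv.
apply: le_integrable (integrableD mU (Lp_integrable_powR mU Lu) (Lp_integrable_powR
    mU Lv)) => //.
  apply/measurable_EFinP; apply: measurable_funM => //; apply: measurable_funM => //.
  by apply: (measurableT_comp (measurable_powR _)); exact: measurableT_comp.
move=> x _; rewrite /= lee_fin [leRHS]ger0_norm ?addr_ge0 ?powR_ge0//.
by rewrite !normrM (ger0_norm (powR_ge0 _ _)) -mulrA ler_powRM_add.
Qed.

End Lp_integrals.

(** * Picone's inequality in integral form, for a negative solution *)

Section picone_inequality.
Context (R : realType) (n : nat) (p : R) (p1 : 1 < p).
Local Notation mu := (lebesgue_rV R n).
Context (Omega : set 'rV[R]_n) (f u : 'rV[R]_n -> R) (lambda : R).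
Context (oOmega : open Omega) (mf : measurable_fun setT (f \_ Omega)).

Let p0 : 0 < p. Proof. exact: lt_trans ltr01 p1. Qed.

Lemma Omega_f0_sub : Omega_f0 Omega f `<=` Omega.
Proof. by move=> x [V [VO _ _] Vx]; exact: VO. Qed.

Lemma Omega_f0_open : open (Omega_f0 Omega f).
Proof. by apply: bigcup_open => V []. Qed.

(** [Omega_f0] is a possibly uncountable union, so null sets cannot simply be collected. On a
    compact subset, finitely many of the open sets suffice. *)
Lemma ae_compact_Omega_f0 (K : set 'rV[R]_n) : compact K -> K `<=` Omega_f0 Omega f ->
  ae_in K (fun x => f x = 0).
Proof.
rewrite compact_cover => cK KU.
have /choice[F hF] : forall x, exists V, K x -> [/\ V `<=` Omega, open V, ae_in V
    (fun x => f x = 0) & V x].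
  move=> x; have [/KU[V [VO oV fV] Vx]|nK] := pselect (K x); first by exists V.
  by exists set0.
have [x Kx|x Kx|D DK cov] := cK _ K F.
- by have [] := hF x Kx.
- by exists x => //; have [] := hF x Kx.
rewrite /ae_in.
have ae_filter : Filter (almost_everywhere mu) by exact: _.
have h := @filter_bigI _ _ D (fun x => [set y | F x y -> f y = 0]) _ ae_filter.
have {}h := h (fun x xD => let: And4 _ _ fx _ := hF x (set_mem (DK x xD)) in fx).
apply: filterS h => y hy Ky; have [x xD Fy] := cov y Ky.
exact: hy x xD Fy.
Qed.

Lemma integral_f_eq0 (K : set 'rV[R]_n) (xi : 'rV[R]_n -> R) : compact K -> K `<=`
    Omega_f0 Omega f ->
  measurable_fun setT (xi \_ Omega) -> (forall x, ~ K x -> xi x = 0) ->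
  \int[mu]_(x in Omega) (f x * xi x) = 0.
Proof.
move=> cK KU mxi xi0.
rewrite Rintegral_mkcond /Rintegral (ae_eq_integral (cst 0%E)) ?integral0//.
  apply/measurable_EFinP; rewrite [X in measurable_fun _ X](_ : _ = (f \_ Omega) \*
      (xi \_ Omega)).
    exact: measurable_funM.
  by apply/funext => x /=; rewrite !patchE; case: ifPn; rewrite ?mulr0.
have : {ae mu, forall x, K x -> f x = 0} by exact: ae_compact_Omega_f0.
apply: filterS => x /= h _; rewrite patchE; case: ifPn => //= _.
have [Kx|/xi0 ->] := pselect (K x); last by rewrite mulr0.
by rewrite h// mul0r.
Qed.

(** The maximum of [u] on [K] is attained and negative. It supplies the constant that ties [s] to
    [th] uniformly on [K]. *)
Lemma negative_on_compact (K : set 'rV[R]_n) : compact K -> K `<=` Omega ->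
  {in Omega, continuous u} -> (forall x, Omega x -> u x < 0) ->
  exists2 c, 0 < c & forall x, K x -> c <= - u x.
Proof.
move=> cK KO cu un.
have [[z Kz]|K0] := pselect (K !=set0); last first.
  by exists 1 => // x Kx; exfalso; apply: K0; exists x.
have cw : {within K, continuous u}.
  have : {within Omega, continuous u} by rewrite continuous_open_subspace.
  exact: continuous_subspaceW.
have [y /set_mem Ky hy] := EVT_max_rV (ex_intro _ z Kz) cK cw.
exists (- u y); first by rewrite oppr_gt0; apply: un; exact: KO.
by move=> x Kx; rewrite lerN2; apply: hy; exact: mem_set.
Qed.

Lemma picone_inequality phi : 0 <= lambda -> negative_solution p Omega f lambda u ->
  Cc_infty (Omega_f0 Omega f) phi ->
  lambda * \int[mu]_x (`|phi x| `^ p) <=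
  \int[mu]_x (enorm (\row_i partial i phi x) `^ p).
Proof.
move=> lam0 [[g Wg weq] cu un] hphi.
have [K [cK KU phi0 dphi0]] := Cc_support hphi.
have KO := subset_trans KU Omega_f0_sub.
have mO := open_measurable_rV oOmega.
have hphiO : Cc_infty Omega phi by apply: (Cc_intro (K := K)) => //; case: hphi.
have [c c0 hc] := negative_on_compact cK KO cu un.
have [[Lu Lg _] _] := Wg.
have [[Lphi Ldphi _] _] := W01p_Cc p1 hphiO.
have iphi := Lp_integrable_powR p1 mO Lphi.
have idphi := Lp_integrable_powR p1 mO (Lp_enorm p1 mO Ldphi).
have ig := Lp_integrable_powR p1 mO (Lp_enorm p1 mO Lg).
have enE (v : 'rV[R]_n -> 'rV[R]_n) : (fun x => (`|enorm (v x)| `^ p)%:E) = (fun x =>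
    (enorm (v x) `^ p)%:E).
  by apply/funext => x; rewrite ger0_norm// enorm_ge0.
rewrite enE in idphi; rewrite enE in ig.
have d0 x : ~ K x -> \row_i partial i phi x = 0 :> 'rV[R]_n.
  by move=> Kx; apply/rowP => i; rewrite !mxE dphi0.
have e00 : enorm (0 : 'rV[R]_n) = 0.
  by rewrite /enorm /dotp big1 ?sqrtr0// => i _; rewrite mxE mul0r.
rewrite -(Rintegral_support (U := Omega)); last first.
  by move=> x Ox; rewrite phi0 ?normr0 ?powR0 ?gt_eqF// => /KO.
rewrite -[leRHS](Rintegral_support (U := Omega)); last first.
  by move=> x Ox; rewrite d0 ?e00 ?powR0 ?gt_eqF// => /KO.
(* On [K], where [|u| >= c], this is the largest [s] such that
   [th * sqrt (u^2 + s) <= |u|]. *)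
pose s th := c ^+ 2 * (1 - th ^+ 2) / th ^+ 2.
set B := \int[mu]_(x in Omega) (enorm (g x) `^ p).
apply: (homogeneous_limit p1 (k := fine (mu K))
  (C := fun th => (p - 1) * Num.sqrt (s th) `^ (- p) * B)).
  by apply: Rintegral_ge0 => x _; exact: powR_ge0.
move=> th e th0 th1 e0.
have th2 : 0 < 1 - th ^+ 2 by rewrite subr_gt0 expr_lt1// ltW.
have s0 : 0 < s th by rewrite divr_gt0 ?mulr_gt0 ?exprn_gt0.
have thM x : K x -> th * Num.sqrt (u x * u x + s th) <= - u x.
  move=> Kx; have cux := hc x Kx; have ux : 0 <= - u x by exact: le_trans (ltW c0) cux.
  rewrite -(ler_pXn2r (n := 2))// ?nnegrE ?mulr_ge0 ?sqrtr_ge0 ?(ltW th0)//.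
  rewrite exprMn sqr_sqrtr; last by rewrite addr_ge0 ?(ltW s0) -?expr2 ?sqr_ge0.
  rewrite mulrDr [th ^+ 2 * s th](_ : _ = c ^+ 2 * (1 - th ^+ 2)); last first.
    by rewrite /s; field; rewrite gt_eqF.
  have : c ^+ 2 <= (- u x) ^+ 2 by rewrite ler_pXn2r ?nnegrE// ltW.
  move=> /(ler_wpM2r (ltW th2)); rewrite !sqrrN !(expr2 (u x)) => h.
  lra.
have [C [bG bG1 lG1]] := reg_bounds p1 s0.
(* Adding [e] makes the power smooth for every real exponent; subtracting [e^(p/2)] makes the result
   vanish off [K] again. *)
pose a x := (phi x * phi x + e) `^ (p / 2) - e `^ (p / 2).
have P0 x : 0 < phi x * phi x + e by rewrite ltr_wpDl// -expr2 sqr_ge0.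
have a0 x : ~ K x -> a x = 0 by move=> Kx; rewrite /a phi0// mulr0 add0r subrr.
have Cphi k : Cn k phi by case: hphi.
have ha : Cc_infty Omega a.
  apply: (Cc_intro (K := K)) => // k.
  apply: CnD; last exact: Cn_cst.
  by apply: Cn_powR => //; apply: CnD; [exact: CnM|exact: Cn_cst].
have da i : partial i a = fun x => p * (phi x * phi x + e) `^ ((p - 2) / 2) * phi x *
    partial i phi x.
  apply: has_partial_eq => x.
  have dphi := CnS_has_partial i (Cphi 1%N) x.
  have h1 := is_deriveD (is_deriveM dphi dphi) (is_derive_cst e x (delta_mx ord0 i)).
  have h2 := is_derive_comp_line h1 (is_derive1_powR (p / 2) (P0 x)).
  have h3 := is_deriveD h2 (is_derive_cst (- e `^ (p / 2)) x (delta_mx ord0 i)).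
  apply: is_derive_eq h3 _.
  rewrite (_ : p / 2 - 1 = (p - 2) / 2); last by field.
  by rewrite /GRing.scale /=; field.
have W := W01p_mul_comp p1 Wg ha (@Cn_reg R p (s th) s0 n) (is_derive_reg p s0)
  (@continuous_reg1 R p (s th) s0) bG bG1 lG1.
set xi := (fun x => a x * reg p (s th) (u x)) in W.
set dxi := (fun x => \row_i _) in W.
have [[Lxi Ldxi _] _] := W.
have := weq xi dxi W.
have xi0 x : ~ K x -> xi x = 0 by move=> Kx; rewrite /xi a0// mul0r.
rewrite (integral_f_eq0 cK KU (Lp_measurable Lxi) xi0) addr0 => eq_weak.
have iflux := integrable_flux p1 mO Lg Ldxi.
have isrc := integrable_source p1 mO Lu Lxi.
have mK := compact_measurable_rV cK.
(* The loss [e^(p/2)] in [source_pointwise] is charged on [K] only, where the measure is finite; off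
   [K] both sides vanish. *)
have i1K : mu.-integrable Omega (EFin \o \1_K).
  apply: (@integrableS _ _ _ _ setT) => //.
  apply: (bounded_support_integrable (K := K) (C := 1)) => //.
  - exact: compact_finite_measure_rV.
  - by move=> x; rewrite ger0_norm// indicE; case: (_ \in _).
  - by move=> x Kx; rewrite indicE memNset.
have iK : mu.-integrable Omega (EFin \o (fun x => e `^ (p / 2) * \1_K x)).
  exact: (integrableZl mO (e `^ (p / 2)) i1K).
have intK : \int[mu]_(x in Omega) (e `^ (p / 2) * \1_K x) = e `^ (p / 2) * fine (mu K).
  rewrite RintegralZl// /Rintegral integral_indic//.
  by congr (_ * fine (mu _)); exact: setIidl.
have iD : mu.-integrable Omega (EFin \o (fun x => `|phi x| `^ p - e `^ (p / 2) * \1_K x)).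
  exact: (integrableB mO iphi iK).
have A : lambda * th `^ (p - 1) * (\int[mu]_(x in Omega) (`|phi x| `^ p) - e `^ (p /
    2) * fine (mu K)) <=
    - lambda * \int[mu]_(x in Omega) (`|u x| `^ (p - 2) * u x * xi x).
  rewrite -intK -RintegralB// -!RintegralZl//; apply: le_Rintegral => //.
  - exact: (integrableZl mO _ iD).
  - exact: (integrableZl mO _ isrc).
  - move=> x Ox; rewrite mulNr; have [Kx|Kx] := pselect (K x).
      rewrite indicE mem_set// mulr1.
      by apply: source_pointwise => //; exact: thM.
    by rewrite indicE memNset// mulr0 subr0 phi0// normr0 powR0 ?gt_eqF// mulr0 xi0//
        !mulr0 oppr0.
(* The weak equation, without its source term, replaces the zero-order integral by the flux
   integral, which [picone_pointwise] bounds from above. *)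
rewrite mulNr -eq_weak -[X in _ <= X]mulN1r -[X in _ <= X]RintegralZl// in A.
apply: (le_trans A).
pose k := (p - 1) * e `^ (p / 2) * Num.sqrt (s th) `^ (- p).
have k0 : 0 <= k by rewrite !mulr_ge0 ?powR_ge0// subr_ge0 ltW.
rewrite [leRHS](_ : _ = th `^ (1 - p) * \int[mu]_(x in Omega) (enorm (\row_i partial
    i phi x) `^ p) + k * B); last first.
  by rewrite /k; ring.
rewrite -!RintegralZl// -RintegralD//; last 2 first.
  exact: (integrableZl mO _ idphi).
  exact: (integrableZl mO _ ig).
apply: le_Rintegral => //.
- exact: (integrableZl mO _ iflux).
- exact: (integrableD mO (integrableZl mO _ idphi) (integrableZl mO _ ig)).
move=> x Ox; rewrite mulN1r; have [Kx|Kx] := pselect (K x).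
  have := picone_pointwise p1 (g x) (\row_i partial i phi x) (phi x) e0 s0 th0 (ltW
      th1) (thM x Kx).
  rewrite /k; congr (- (_ * dotp _ _) <= _).
  by apply/rowP => i; rewrite !mxE da.
have -> : dxi x = 0.
  by apply/rowP => i; rewrite !mxE da a0// phi0// !(mulr0, mul0r) addr0.
rewrite {1}/dotp big1 ?mulr0 ?oppr0 => [|i _]; last by rewrite mxE mulr0.
apply: addr_ge0; apply: mulr_ge0 => //; exact: powR_ge0.
Qed.

End picone_inequality.

(** * Rayleigh quotients *)

Section rayleigh_quotient.
Context (R : realType) (n : nat) (p : R) (p1 : 1 < p).
Local Notation mu := (lebesgue_rV R n).
Local Notation N f := ('N[mu]_p%:E[EFin \o f%R])%E.
Implicit Types (U : set 'rV[R]_n) (v : 'rV[R]_n -> R) (h : 'rV[R]_n -> 'rV[R]_n).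

Let p0 : 0 < p. Proof. exact: lt_trans ltr01 p1. Qed.
Let pV0 : 0 <= p^-1. Proof. by rewrite invr_ge0 ltW. Qed.

Lemma Lnorm_fine (f : 'rV[R]_n -> R) : (N f < +oo)%E ->
  N f = ((\int[mu]_x (`|f x| `^ p)) `^ p^-1)%:E.
Proof.
move=> fo; rewrite Lnorm_EFinE -poweR_EFin /Rintegral fineK//.
rewrite ge0_fin_numE; first by rewrite -(Lnorm_lty mu (ltW p1)).
by apply: integral_ge0 => x _; rewrite lee_fin powR_ge0.
Qed.

Lemma Rintegral_powR_patch U (f : 'rV[R]_n -> R) :
  \int[mu]_(x in U) (`|f x| `^ p) = \int[mu]_x (`|(f \_ U) x| `^ p).
Proof.
rewrite Rintegral_mkcond; apply: eq_Rintegral => x _; rewrite !patchE.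
by case: ifPn => //; rewrite normr0 powR0// gt_eqF.
Qed.

Lemma Rintegral_powR_ge0 (f : 'rV[R]_n -> R) : 0 <= \int[mu]_x (`|f x| `^ p).
Proof. by apply: Rintegral_ge0 => x _; exact: powR_ge0. Qed.

(** The inequality is passed to the limit after taking [p]-th roots: L^p norms, unlike the integrals
    themselves, are controlled by the triangle inequality along the approximating sequence. *)
Lemma le_rayleigh U v h (lam : R) : measurable U -> 0 <= lam ->
  (forall phi, Cc_infty U phi -> lam * \int[mu]_x (`|phi x| `^ p) <=
     \int[mu]_x (enorm (\row_i partial i phi x) `^ p)) ->
  W01p p U v h -> ~ ae_in U (fun x => v x = 0) -> lam <= rayleigh p U v h.
Proof.
move=> mU lam0 ineq [[Lv Lh _] [w [hw cw cdw]]] v0.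
have LE := Lp_enorm p1 mU Lh.
have [mv Nv] := (in_LfunP mu p _).1 Lv; have [mE NE] := (in_LfunP mu p _).1 LE.
have mh i := Lp_measurable (Lh i).
rewrite /rayleigh Rintegral_powR_patch.
rewrite [X in X / _](_ : _ = \int[mu]_x (`|((fun x => enorm (h x)) \_ U) x| `^ p));
    last first.
  by rewrite -Rintegral_powR_patch; apply: eq_Rintegral => x _; rewrite ger0_norm//
      enorm_ge0.
set Y := \int[mu]_x _; set X := \int[mu]_x _.
have X0 : 0 <= X by exact: Rintegral_powR_ge0.
have Y0 : 0 <= Y by exact: Rintegral_powR_ge0.
have NX := Lnorm_fine Nv; have NY := Lnorm_fine NE; rewrite -/X in NX; rewrite -/Y in NY.
clearbody X Y.
have X_gt0 : 0 < X.
  rewrite lt_neqAle X0 andbT; apply/eqP => /esym X_eq0; apply: v0.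
  rewrite X_eq0 powR0 ?invr_eq0 ?gt_eqF// in NX.
  have p0E : (0 < p%:E)%E by rewrite lte_fin.
  have mvE : measurable_fun setT (EFin \o (v \_ U)) by apply/measurable_EFinP.
  have := Lnorm_eq0_eq0 mvE p0E NX.
  apply: filterS => x /(_ I) /= + Ux; rewrite patchE mem_set// => -[].
  exact.
rewrite ler_pdivlMr//.
have main : lam `^ p^-1 * X `^ p^-1 <= Y `^ p^-1.
  apply/ler_addgt0Pr => e e0.
  (* Replacing [v] by [w k] costs [lam^(1/p) * e'], and each of the [n] gradient components costs
     [e']; the final 1 keeps [c] positive. *)
  pose c := lam `^ p^-1 + n%:R + 1.
  have l0 : 0 <= lam `^ p^-1 by exact: powR_ge0.
  have c0 : 0 < c by rewrite /c ltr_wpDl// addr_ge0.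
  pose e' := e / c; have e'0 : 0 < e' by rewrite divr_gt0.
  have [k _ /(_ k (leqnn k)) /= [hk hdk]] : \forall k \near \oo,
      (N ((w k \- v)%R \_ U) < e'%:E)%E /\
      (forall i, (N ((partial i (w k) \- (fun x => h x ord0 i))%R \_ U) < e'%:E)%E).
    near=> k; split; first by near: k; exact: ((Lp_cvgP _ _ _ _).1 cw).
    near: k; apply: filter_forall => i; exact: ((Lp_cvgP _ _ _ _).1 (cdw i)).
  have mw := measurable_Cc (hw k); have mdw i := measurable_Cc_partial i (hw k).
  have Nw := Cc_Lnorm_lty (ltW p1) (hw k).
  have [[_ Ldw _] _] := W01p_Cc p1 (hw k).
  have LD := Lp_enorm p1 mU Ldw.
  have Dsupp : (fun x => enorm (\row_i partial i (w k) x)) \_ U = (fun x => enorm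
      (\row_i partial i (w k) x)).
    apply/funext => x; rewrite patchE; case: ifPn => //; rewrite notin_setE => Ux.
    have [K [_ KU _ d0]] := Cc_support (hw k).
    rewrite /enorm /dotp big1 ?sqrtr0// => i _.
    by rewrite mxE d0 ?mul0r// => /KU.
  have [mD ND] := (in_LfunP mu p _).1 LD; rewrite Dsupp in mD ND.
  rewrite patch_sub (patch_Cc (hw k)) in hk.
  have h1 : X `^ p^-1 <= (\int[mu]_x (`|w k x| `^ p)) `^ p^-1 + e'.
    rewrite -lee_fin -NX (EFinD (_ `^ _)) -(Lnorm_fine Nw).
    apply: (@le_trans _ _ (1%:E * N (w k) + 1%:E * N (w k \- (v \_ U)))%E).
      apply: (le_LnormD mu (ltW p1)) => //.
        by apply: measurable_funB; [exact: mw|exact: mv].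
      move=> x; rewrite !mul1r /=.
      by have := ler_normB (w k x) (w k x - (v \_ U) x); rewrite opprB addrC subrK.
    by rewrite !mul1e; apply: leeD => //; exact: ltW.
  have h2 : (\int[mu]_x (enorm (\row_i partial i (w k) x) `^ p)) `^ p^-1 <= Y `^ p^-1
      + n%:R * e'.
    rewrite -lee_fin (EFinD (Y `^ _)) -NY.
    have := Lnorm_fine ND.
    rewrite [X in X `^ _](_ : _ = \int[mu]_x (enorm (\row_i partial i (w k) x) `^
        p)); last first.
      by apply: eq_Rintegral => x _; rewrite ger0_norm// enorm_ge0.
    move=> <-.
    apply: (@le_trans _ _ (N ((fun x => enorm (h x)) \_ U) + \sum_(i < n) N (partial
        i (w k) \- ((fun x => h x ord0 i) \_ U)))%E).
      apply: (Lnorm_le_sum p1) => //.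
        by move=> i; apply: measurable_funB; [exact: mdw|exact: mh].
      move=> x; have Dx := congr1 (fun F => F x) Dsupp; rewrite /= in Dx.
      rewrite -Dx !patchE; case: ifPn => xU.
        rewrite !ger0_norm ?enorm_ge0//.
        rewrite -{1}[\row_i partial i (w k) x](subrKC (h x)).
        apply: (le_trans (enormD _ _)); rewrite lerD2l.
        apply: (le_trans (enorm_le_sum _)); apply: ler_sum => i _.
        by rewrite !mxE /= patchE xU.
      by rewrite normr0 add0r sumr_ge0.
    apply: leeD => //; apply: (@le_trans _ _ (\sum_(i < n) e'%:E)%E).
      apply: lee_sum => i _; have := hdk i.
      by rewrite patch_sub (patch_partial_Cc _ (hw k)) => /ltW.
    by rewrite sumEFin lee_fin sumr_const card_ord mulr_natl.
  have h3 : lam `^ p^-1 * (\int[mu]_x (`|w k x| `^ p)) `^ p^-1 <=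
      (\int[mu]_x (enorm (\row_i partial i (w k) x) `^ p)) `^ p^-1.
    rewrite -powRM//; last exact: Rintegral_powR_ge0.
    apply: ge0_ler_powR => //; rewrite ?nnegrE.
    - by rewrite mulr_ge0// Rintegral_powR_ge0.
    - by apply: Rintegral_ge0 => x _; exact: powR_ge0.
    - exact: ineq.
  have h4 : e' * c = e by rewrite /e' divfK// gt_eqF.
  apply: (le_trans (ler_wpM2l l0 h1)); rewrite mulrDr.
  apply: (le_trans (lerD (le_trans h3 h2) (lexx _))).
  rewrite -addrA lerD2l -h4 -mulrDl mulrC; apply: ler_wpM2l; first exact: ltW.
  by rewrite /c [n%:R + _]addrC lerDl.
have := @ge0_ler_powR R p (ltW p0) _ _ _ _ main.
rewrite !nnegrE mulr_ge0 ?powR_ge0// => /(_ isT isT).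
by rewrite -powRM// -!powRrM mulVf ?gt_eqF// !powRr1// mulr_ge0.
Unshelve. all: by end_near.
Qed.

Lemma lambda1_ge0 U : (0 <= lambda1 p U)%E.
Proof.
apply: le_ereal_inf_tmp => _ [v [h [_ _ ->]]]; rewrite lee_fin /rayleigh.
by rewrite divr_ge0//; apply: Rintegral_ge0 => x _; exact: powR_ge0.
Qed.

End rayleigh_quotient.

Theorem corollary1p7 (R : realType) (n : nat) (p gamma : R)
    (Omega : set 'rV[R]_n.+1) (f : 'rV[R]_n.+1 -> R)
    (p_gt1 : 1 < p) (Omega_C11 : C11_domain Omega)
    (gamma_gtN : n.+1%:R < gamma) (f_Lgamma : Lp gamma Omega f)
    (f_ge0 : ae_in Omega (fun x => 0 <= f x))
    (f_neq0 : ~ ae_in Omega (fun x => f x = 0))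
    (Omega_f0_neq0 : Omega_f0 Omega f !=set0) :
  (lambda_tilde p Omega f <= lambda1 p (Omega_f0 Omega f))%E /\
  (lambda1 p (Omega_f0 Omega f) < +oo)%E.
Proof.
have [_ oOmega _ _ _] := Omega_C11.
have oU := @Omega_f0_open _ _ Omega f.
split; last exact: lambda1_lty.
have mf := Lp_measurable f_Lgamma.
apply: ge_ereal_sup => _ [lambda [lt_lambda [u hu]] <-].
apply: le_ereal_inf_tmp => _ [v [h [Wv v0 ->]]]; rewrite lee_fin.
(* Admissible parameters exceed [lambda1 p Omega], an infimum of nonnegative quotients. This sign is
   used in the pointwise source estimate and in taking [p]-th roots. *)
have lambda0 : 0 <= lambda.
  by rewrite -lee_fin (le_trans (lambda1_ge0 p Omega))// ltW.
apply: (le_rayleigh p_gt1 (open_measurable_rV oU) lambda0 _ Wv v0) => phi hphi.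
exact: picone_inequality hu hphi.
Qed.
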